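(* Let $d \geq 2$ be an integer and let $\varepsilon > 0$. There exists $q_0$ (depending on $d$ and $\varepsilon$) such that the following holds for every odd prime power $q \geq q_0$. Let $Q$ be a non-degenerate quadratic form on $\mathbb{F}_q^d$ and let $E \subset \mathbb{F}_q^d$ satisfy $|E| \geq 3 q^{\frac{d}{2}+\varepsilon}$. Then $$|\Delta_Q(E)| \geq \min\left\{ \frac{|E|}{3 q^{(d-1)/2}},\ q \right\}.$$
   Context: $\mathbb{F}_q$ is the finite field with $q$ elements. For a non-degenerate quadratic form $Q$ on $\mathbb{F}_q^d$ and $E \subset \mathbb{F}_q^d$, the distance set of $E$ with respect to $Q$ is $\Delta_Q(E) = \{Q(x-y) : x, y \in E\} \subset \mathbb{F}_q$ (the case $x=y$ is allowed). *)

(* Defs.v *)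
From mathcomp Require Import all_boot all_order all_algebra.
From mathcomp Require Import sesquilinear.
From mathcomp Require Import reals exp.

Set Implicit Arguments.
Unset Strict Implicit.
Unset Printing Implicit Defensive.

Import Order.TTheory GRing.Theory Num.Theory.

Local Open Scope ring_scope.

(* No factor 1/2: [polar Q x x = 2 * Q x] for a quadratic form [Q]. *)
Definition polar (F : fieldType) (d : nat) (Q : 'rV[F]_d -> F)
  (x y : 'rV[F]_d) : F := Q (x + y) - Q x - Q y.

Definition quadratic_form (F : fieldType) (d : nat) (Q : 'rV[F]_d -> F) : Prop :=
  (forall (a : F) (x : 'rV[F]_d), Q (a *: x) = a ^+ 2 * Q x) /\
  bilinear_for *%R *%R (polar Q).

(* Appropriate in characteristic different from 2, where [Q] and [polar Q]
   determine each other. *)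
Definition nondegenerate_quadratic_form (F : fieldType) (d : nat)
  (Q : 'rV[F]_d -> F) : Prop :=
  quadratic_form Q /\
  (forall x : 'rV[F]_d, (forall y : 'rV[F]_d, polar Q x y = 0) -> x = 0).

Definition distance_set (F : finFieldType) (d : nat) (Q : 'rV[F]_d -> F)
  (E : {set 'rV[F]_d}) : {set F} := [set Q (x - y) | x in E, y in E].

(* Main.v *)
(** A Fourier expansion over the additive characters psi of F_q, with the polar form B of Q
    as pairing, gives, for nu(t) = #{(x, y) in E^2 : Q(x - y) = t},

      q^d (q nu(t) - |E|^2) = sum_m |E^(m)|^2 sum_{s <> 0} G(s) psi(- s t - Q(m) / s),

    where G(s) = sum_z psi(s Q(z)) has modulus q^(d/2).  As G(s)^2 = G(1)^2, the function
    s |-> G(s) / G(1) is either 1 or the quadratic character, so for t <> 0 the inner sum is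
    a Kloosterman or a Salie sum, of modulus at most 2 sqrt q.  Salie sums are explicit.
    For Kloosterman sums K: if L / F is quadratic and K_L is the sum of the lifted
    character, then K_L = 2 q - K^2; hence |K| > 2 sqrt q would make K_L^2 / |L| unbounded
    along a tower of quadratic extensions, whereas Stepanov's polynomial method, applied to
    sum_y eta((y^q - y + v)^2 - 4 c), shows that this ratio stays bounded.

    With s = |E| / q^((d+1)/2), the conclusion comes from the pointwise upper bound on nu
    if s <= 1/2 (here the exponent eps makes nu(0) negligible), from the second moment of
    nu if 1/2 <= s <= 5/2, and from the positivity of nu if s > 5/2. *)

Require Import Defs.
From mathcomp Require Import all_boot all_order all_fingroup all_algebra.
From mathcomp Require Import all_field all_character.
From mathcomp Require Import ring lra zify.
From mathcomp Require Import reals exp.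

Set Implicit Arguments.
Unset Strict Implicit.
Unset Printing Implicit Defensive.

Import Order.TTheory GRing.Theory Num.Theory.

Local Open Scope ring_scope.

(** * The quadratic character *)

Section QuadraticCharacter.

Variable F : finFieldType.
Hypothesis oddF : odd #|F|.

(** Euler's criterion serves as the definition: multiplicativity is then immediate, and Stepanov's
    method sees the value as a power of the argument. *)
Definition quad_char (x : F) : algC :=
  if x == 0 then 0 else if x ^+ (#|F|.-1)./2 == 1 then 1 else -1.

Local Notation eta := quad_char.

Lemma odd_card_two_neq0 : (2 : F) != 0.
Proof.
have [p p_pr pF] := finPcharP F.
rewrite -(dvdn_pcharf pF) dvdn_prime2 //; apply/eqP => p2.
move: pF oddF (finNzRing_gt1 F); rewrite p2 => pF.
have -> : #|F| = (2 ^ logn 2 #|F|)%N := card_pprimeChar pF.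
by case: (logn _ _) => [|n]; rewrite ?expn0 // expnS oddM.
Qed.

Let two_neq0 := odd_card_two_neq0.

Lemma expf_card_pred (x : F) : x != 0 -> x ^+ (#|F|.-1) = 1.
Proof.
move=> x0; apply: (mulIf x0); rewrite mul1r -exprSr prednK ?expf_card //.
exact: ltnW (finNzRing_gt1 F).
Qed.

Lemma half_card_double : ((#|F|.-1)./2.*2 = #|F|.-1)%N.
Proof. by move: oddF (finNzRing_gt1 F); move: #|F| => q; lia. Qed.

Lemma half_card_gt0 : (0 < (#|F|.-1)./2)%N.
Proof. by move: oddF (finNzRing_gt1 F); move: #|F| => q; lia. Qed.

Lemma quad_char0 : eta 0 = 0.
Proof. by rewrite /eta eqxx. Qed.

Lemma expf_half_card (x : F) : x != 0 ->
  (x ^+ (#|F|.-1)./2 == 1) || (x ^+ (#|F|.-1)./2 == -1).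
Proof.
move=> x0; rewrite -eqf_sqr expr1n -exprM muln2 half_card_double.
by rewrite expf_card_pred.
Qed.

Lemma one_neqN1 : (1 : F) != -1.
Proof. by rewrite -addr_eq0. Qed.

Lemma quad_charM x y : eta (x * y) = eta x * eta y.
Proof.
rewrite /eta mulf_eq0.
have [->|x0] := eqVneq x 0; first by rewrite /= mul0r.
have [->|y0] := eqVneq y 0; first by rewrite orbT mulr0.
rewrite /= exprMn.
have N11 : (-1 == 1 :> F) = false by rewrite eq_sym; exact: negbTE one_neqN1.
by case/orP: (expf_half_card x0) => /eqP ->; case/orP: (expf_half_card y0) => /eqP ->;
  rewrite ?(mulr1, mul1r, mulrNN, eqxx, N11).
Qed.

Lemma quad_char_sqr x : x != 0 -> eta (x ^+ 2) = 1.
Proof.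
move=> x0; rewrite /eta expf_eq0 (negbTE x0) /= -exprM mulnC muln2.
by rewrite half_card_double expf_card_pred // eqxx.
Qed.

Lemma quad_char_cases x : x != 0 -> eta x = 1 \/ eta x = -1.
Proof. by rewrite /eta => /negbTE ->; case: ifP; [left|right]. Qed.

Lemma quad_char_norm x : x != 0 -> `|eta x| = 1.
Proof. by case/quad_char_cases => ->; rewrite ?normrN normr1. Qed.

Lemma quad_char_sq1 x : x != 0 -> eta x * eta x = 1.
Proof. by case/quad_char_cases => ->; rewrite ?mulrNN mulr1. Qed.

Lemma quad_charV x : eta x^-1 = eta x.
Proof.
have [->|x0] := eqVneq x 0; first by rewrite invr0.
have e0 : eta x != 0 by rewrite -normr_eq0 quad_char_norm // oner_eq0.
by apply: (mulfI e0); rewrite -quad_charM divff // quad_char_sq1 //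
  -(quad_char_sqr (oner_neq0 F)) expr1n.
Qed.

Lemma conj_quad_char x : (eta x)^* = eta x.
Proof.
by rewrite /eta; case: ifP => _; rewrite ?rmorph0 //; case: ifP => _;
  rewrite ?rmorph1 ?rmorphN1.
Qed.

Lemma card_sqrt_sqr (e : F) : #|[set s | s ^+ 2 == e ^+ 2]| = if e == 0 then 1%N else 2%N.
Proof.
have -> : [set s | s ^+ 2 == e ^+ 2] = [set e; - e].
  by apply/setP => s; rewrite !inE eqf_sqr.
rewrite cards2 -addr_eq0 -mulr2n -mulr_natl mulf_eq0 (negbTE two_neq0) /=.
by case: eqP.
Qed.

(* The squares are half of the nonzero elements, and X^((q-1)/2) - 1 has no
   more roots than that. *)
Lemma quad_char1_sqr x : eta x = 1 -> exists e, x = e ^+ 2.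
Proof.
move=> ex; have x0 : x != 0.
  by apply: contra_eq_neq ex => ->; rewrite quad_char0 eq_sym oner_neq0.
set h := (#|F|.-1)./2.
pose A := [set y : F | y ^+ h == 1].
pose S := [set y ^+ 2 | y in [set~ (0 : F)]].
have SA : S \subset A.
  apply/subsetP => z /imsetP[y + ->]; rewrite !inE => y0.
  by rewrite -exprM mulnC muln2 half_card_double expf_card_pred.
have cardA : (#|A| <= h)%N.
  have hp : 'X^h - 1 != 0 :> {poly F}.
    by rewrite -size_poly_eq0 size_XnsubC ?half_card_gt0.
  rewrite cardE -ltnS -(size_XnsubC (1 : F) half_card_gt0).
  apply: max_poly_roots; rewrite ?enum_uniq //.
  apply/allP => y; rewrite mem_enum inE => /eqP yh.
  by rewrite /root !hornerE yh subrr.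
have cardS : (h <= #|S|)%N.
  rewrite -leq_double half_card_double -(cardsC1 (0 : F)) -sum1_card.
  rewrite (partition_big_imset (fun y : F => y ^+ 2)) -muln2 -sum_nat_const.
  apply: leq_sum => _ /imsetP[y y0 ->]; rewrite sum1dep_card.
  have c2 : (#|[set s | s ^+ 2 == y ^+ 2]| <= 2)%N by rewrite card_sqrt_sqr; case: eqP.
  apply: leq_trans c2.
  by apply/subset_leq_card/subsetP => z; rewrite !inE => /andP[].
have : x \in S.
  have /eqP -> : S == A by rewrite eqEcard SA (leq_trans cardA).
  by rewrite inE; move: ex; rewrite /eta (negbTE x0); case: eqP => // _ /eqP;
    rewrite eqNr oner_eq0.
by case/imsetP => e _ ->; exists e.
Qed.

Lemma card_sqrt x : #|[set s | s ^+ 2 == x]|%:R = 1 + eta x :> algC.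
Proof.
have [->|x0] := eqVneq x 0.
  by have := card_sqrt_sqr 0; rewrite expr0n eqxx quad_char0 addr0 => ->.
have [ex|ex] := quad_char_cases x0.
  have [e xe] := quad_char1_sqr ex; move: x0; rewrite ex xe card_sqrt_sqr.
  by rewrite expf_eq0 /= => /negbTE ->.
rewrite ex subrr; apply/eqP; rewrite pnatr_eq0 cards_eq0; apply/eqP/setP => s.
rewrite !inE; apply/eqP => xs; move/eqP: ex; apply/negP.
have s0 : s != 0 by apply: contraNneq x0 => s0; rewrite -xs s0 expr0n.
by rewrite -xs quad_char_sqr // eq_sym eqNr oner_eq0.
Qed.

(** Completing the square: [x |-> 2 * x - s] sends the roots onto the square roots of the
    discriminant. *)
Lemma card_quad_roots s n :
  #|[set x | x ^+ 2 - s * x + n == 0]|%:R = 1 + eta (s ^+ 2 - 4 * n) :> algC.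
Proof.
rewrite -card_sqrt -(card_imset _ (can_inj (fun x => mulKf two_neq0 x))).
rewrite -(card_imset _ (@addIr _ (- s))); congr _%:R; apply: eq_card => y.
apply/imsetP/idP => [[_ /imsetP[x + ->] ->]|].
  rewrite !inE => /eqP xP; apply/eqP.
  by rewrite -[RHS]addr0 -[in RHS](mulr0 4) -xP; ring.
rewrite inE => /eqP yP; exists (2 * (2^-1 * (y + s))); last first.
  by rewrite mulVKf // addrK.
apply/imsetP; exists (2^-1 * (y + s)) => //; rewrite inE.
rewrite -(inj_eq (mulfI two_neq0)) -(inj_eq (mulfI two_neq0)) !mulr0.
have -> : 2 * (2 * ((2^-1 * (y + s)) ^+ 2 - s * (2^-1 * (y + s)) + n)) =
          y ^+ 2 - (s ^+ 2 - 4 * n) by field.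
by rewrite yP subrr.
Qed.

Lemma sum_fiber (T : finType) (P : pred T) (g : T -> F) (f : F -> algC) :
  \sum_(x | P x) f (g x) = \sum_v f v * #|[set x | P x & g x == v]|%:R.
Proof.
rewrite (partition_big g predT) //=; apply: eq_bigr => v _.
rewrite (eq_bigr (fun=> f v)) => [|x /andP[_ /eqP ->] //].
by rewrite sumr_const cardsE mulr_natr.
Qed.

Lemma sum_quad_char : \sum_x eta x = 0.
Proof.
have := sum_fiber predT (fun s => s ^+ 2) (fun=> 1).
under [RHS]eq_bigr => v _ do rewrite mul1r card_sqrt.
rewrite big_split /= => /eqP.
by rewrite eq_sym -subr_eq0 addrAC subrr add0r => /eqP.
Qed.

Lemma exists_nonsquare : exists nu, eta nu = -1.
Proof.
have [/existsP[nu /eqP ?]|] := boolP [exists nu, eta nu == -1]; first by exists nu.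
rewrite negb_exists => /forallP nsq.
have := sum_quad_char; rewrite (bigD1 0) //= quad_char0 add0r.
rewrite (eq_bigr (fun=> 1)) => [|x x0]; last first.
  by case: (quad_char_cases x0) => // ex; have := nsq x; rewrite ex eqxx.
rewrite sumr_const => /eqP; rewrite pnatr_eq0 cardC1.
by move: oddF (finNzRing_gt1 F); move: #|F| => q; lia.
Qed.

End QuadraticCharacter.

(** * Additive characters, Gauss and Salie sums *)

Definition add_char (F : finFieldType) (psi : F -> algC) : Prop :=
  [/\ {morph psi : x y / x + y >-> x * y}, psi 0 = 1 & exists x, psi x != 1].

(** A nonprincipal irreducible character of the additive group works; it is linear because the group
    is abelian. *)
Lemma exists_add_char (F : finFieldType) : exists psi : F -> algC, add_char psi.
Proof.
have abF : abelian [set: F] by exact: FinRing.zmod_abelian.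
have : (1 < #|Iirr [set: F]|)%N.
  by rewrite card_Iirr_abelian // cardsT finNzRing_gt1.
rewrite (cardD1 (0 : Iirr [set: F])) inE => /card_gt0P[i]; rewrite !inE andbT => i0.
have lin : 'chi_i \is a linear_char by apply/char_abelianP.
exists 'chi_i; split.
- by move=> x y; apply: lin_charM; rewrite ?inE.
- exact: lin_char1.
apply/existsP; apply: contraNT i0; rewrite negb_exists => /forallP all1.
rewrite -irr_eq1; apply/eqP/cfunP => x; rewrite cfun1E inE.
by apply/eqP; rewrite -[_ == _]negbK all1.
Qed.

Section AdditiveCharacter.

Variables (F : finFieldType) (psi : F -> algC).
Hypothesis psiP : add_char psi.

Let psiD : {morph psi : x y / x + y >-> x * y}. Proof. by case: psiP. Qed.
Let psi0 : psi 0 = 1. Proof. by case: psiP. Qed.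

Lemma add_char_norm x : `|psi x| = 1.
Proof.
have psiMn n : psi (x *+ n) = psi x ^+ n.
  by elim: n => [|n IHn]; rewrite ?mulr0n // mulrS psiD IHn exprS.
have [p p_pr pF] := finPcharP F.
apply/eqP; rewrite -(@pexpr_eq1 _ _ p) ?prime_gt0 //.
by rewrite -normrX -psiMn -mulr_natr (pcharf0 pF) mulr0 psi0 normr1.
Qed.

Lemma add_char_conj x : (psi x)^* = psi (- x).
Proof.
have n0 : psi x != 0 by rewrite -normr_eq0 add_char_norm oner_eq0.
apply: (mulfI n0); rewrite -normCK add_char_norm expr1n.
by rewrite -psiD subrr psi0.
Qed.

Lemma sum_add_char a : \sum_x psi (a * x) = if a == 0 then #|F|%:R else 0.
Proof.
have [->|a0] := eqVneq a 0.
  under eq_bigr => x _ do rewrite mul0r psi0.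
  by rewrite sumr_const.
have [_ _ [x x1]] := psiP.
have: psi x * (\sum_x psi (a * x)) = \sum_x psi (a * x).
  rewrite mulr_sumr [RHS](reindex_inj (addrI (x / a))) /=.
  by apply: eq_bigr => y _; rewrite -psiD mulrDr [a * (_ / _)]mulrC divfK.
move/eqP; rewrite -subr_eq0 -[X in _ - X]mul1r -mulrBl mulf_eq0 subr_eq0.
by rewrite (negbTE x1) => /eqP.
Qed.

Lemma sum_add_char1 : \sum_x psi x = 0.
Proof.
transitivity (\sum_x psi (1 * x)); last by rewrite sum_add_char oner_eq0.
by apply: eq_bigr => x _; rewrite mul1r.
Qed.

Lemma add_char_scale a : a != 0 -> add_char (fun x => psi (a * x)).
Proof.
move=> a0; split=> [x y||]; rewrite ?mulr0 ?mulrDr ?psiD //.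
by have [_ _ [x x1]] := psiP; exists (x / a); rewrite mulrC divfK.
Qed.

Definition gauss_sum := \sum_x quad_char x * psi x.

Definition kloosterman c := \sum_(x | x != 0) psi (x + c / x).

Definition salie c := \sum_(x | x != 0) quad_char x * psi (x + c / x).

Hypothesis oddF : odd #|F|.
Local Notation eta := (@quad_char F).
Local Notation q := (#|F|%:R : algC).

(** Substituting [u = w * v] in the double sum leaves a sum over [v] given by orthogonality: [w = 1]
    contributes q, and the constant -1 is killed by [sum_quad_char]. *)
Lemma gauss_sum_norm : `|gauss_sum| ^+ 2 = q.
Proof.
rewrite normCK /gauss_sum rmorph_sum big_distrlr exchange_big /=.
transitivity (\sum_(v | v != 0) \sum_w eta w * psi ((w - 1) * v)).
  rewrite [LHS](bigD1 0) //= big1 ?add0r => [|u _]; last first.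
    by rewrite quad_char0 mul0r conjC0 mulr0.
  apply: eq_bigr => v v0; rewrite [LHS](reindex_inj (mulIf v0)) /=.
  apply: eq_bigr => w _; rewrite rmorphM /= add_char_conj quad_charM //.
  rewrite conj_quad_char.
  rewrite mulrBl mul1r psiD; move: (quad_char_sq1 v0) => e1.
  by rewrite -[RHS]mulr1 -e1; ring.
rewrite exchange_big /=.
have sumv w : \sum_(v | v != 0) psi ((w - 1) * v) = (if w == 1 then q else 0) - 1.
  have := sum_add_char (w - 1); rewrite (bigD1 0) //= mulr0 psi0 subr_eq0.
  by move <-; rewrite [1 + _]addrC addrK.
under eq_bigr => w _ do rewrite -mulr_sumr sumv mulrBr mulr1.
rewrite sumrB sum_quad_char // subr0 (bigD1 1) //= eqxx.
rewrite big1 ?addr0 => [|w /negbTE ->]; last by rewrite mulr0.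
by have := quad_char_sqr oddF (oner_neq0 F); rewrite expr1n => ->; rewrite mul1r.
Qed.

Lemma card_add_div_fiber c v : c != 0 ->
  #|[set x | x != 0 & x + c / x == v]|%:R = 1 + eta (v ^+ 2 - 4 * c) :> algC.
Proof.
move=> c0; rewrite -card_quad_roots //; congr _%:R; apply: eq_card => x.
rewrite !inE; have [->|x0] /= := eqVneq x 0.
  by rewrite expr0n mulr0 subr0 add0r (negbTE c0).
rewrite -(inj_eq (mulfI x0)) mulrDr [x * (c / x)]mulrC divfK // -subr_eq0.
by congr (_ == 0); ring.
Qed.

(** Sorting by the value of [x + c / x] produces the weight 1 + eta, whose 1 sums to zero. This form
    is the one that Stepanov's method can treat. *)
Lemma kloosterman_quad_char c : c != 0 ->
  kloosterman c = \sum_v psi v * eta (v ^+ 2 - 4 * c).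
Proof.
move=> c0; rewrite /kloosterman (sum_fiber (fun x => x != 0) (fun x => x + c / x)).
under eq_bigr => v _ do rewrite card_add_div_fiber // mulrDr mulr1.
by rewrite big_split /= sum_add_char1 add0r.
Qed.

Lemma kloosterman_real c : kloosterman c \is Num.real.
Proof.
rewrite CrealE /kloosterman rmorph_sum (reindex_inj oppr_inj) /=.
apply/eqP; apply: eq_big => [x|x _]; first by rewrite oppr_eq0.
by rewrite /= add_char_conj opprD opprK invrN mulrN opprK.
Qed.

End AdditiveCharacter.

Section Salie.

Variables (F : finFieldType) (psi : F -> algC).
Hypotheses (psiP : add_char psi) (oddF : odd #|F|).
Local Notation eta := (@quad_char F).
Local Notation q := (#|F|%:R : algC).

Let psiD : {morph psi : x y / x + y >-> x * y}. Proof. by case: psiP. Qed.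

Lemma gauss_sum_shift a : \sum_x psi x * eta (x - a) = psi a * gauss_sum psi.
Proof.
rewrite (reindex_inj (addIr a)) /gauss_sum mulr_sumr.
by apply: eq_bigr => x _; rewrite addrK psiD; ring.
Qed.

(** Since x + e^2/x - 2e = (x - e)^2/x, the factor eta(x) depends only on v = x + e^2/x when x
    differs from e. Sorting by v and factoring v^2 - 4e^2 gives two shifted Gauss sums. *)
Lemma salie_sqr e : e != 0 ->
  salie psi (e ^+ 2) = (psi (2 * e) + psi (- (2 * e))) * gauss_sum psi.
Proof.
move=> e0; have e20 : e ^+ 2 != 0 by rewrite expf_eq0.
have two0 := odd_card_two_neq0 oddF.
have sum_minus : salie psi (e ^+ 2) =
    \sum_(x | x != 0) psi (x + e ^+ 2 / x) * eta (x + e ^+ 2 / x - 2 * e)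
    + eta e * psi (2 * e).
  rewrite /salie (bigD1 e) //= [in RHS](bigD1 e) //=.
  have -> : e + e ^+ 2 / e = 2 * e by rewrite expr2 mulfK // mulr2n mulrDl mul1r.
  rewrite subrr quad_char0 mulr0 add0r addrC; congr (_ + _).
  apply: eq_bigr => x /andP[x0 xe]; rewrite mulrC; congr (_ * _).
  have -> : x + e ^+ 2 / x - 2 * e = (x - e) ^+ 2 / x by field.
  by rewrite quad_charM // quad_charV // quad_char_sqr ?subr_eq0 // mul1r.
pose f v := psi v * eta (v - 2 * e).
rewrite sum_minus (sum_fiber (fun x => x != 0) (fun x => x + e ^+ 2 / x) f).
under eq_bigr => v _ do rewrite card_add_div_fiber // mulrDr mulr1.
rewrite big_split /= {1}/f gauss_sum_shift [RHS]mulrDl -addrA; congr (_ + _).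
(* The term set aside at x = e is the v = 2e term of the second shifted Gauss sum, because eta(4e) =
   eta(e). *)
rewrite -gauss_sum_shift (bigD1 (2 * e)) //= [RHS](bigD1 (2 * e)) //=.
have -> : (2 * e) ^+ 2 - 4 * e ^+ 2 = 0 by ring.
have -> : 2 * e - - (2 * e) = 2 ^+ 2 * e by ring.
rewrite quad_char0 mulr0 add0r quad_charM // quad_char_sqr // mul1r addrC mulrC.
congr (_ + _); apply: eq_bigr => v ve; rewrite /f.
have -> : v ^+ 2 - 4 * e ^+ 2 = (v - 2 * e) * (v - - (2 * e)) by ring.
rewrite quad_charM // -mulrA; congr (_ * _).
by rewrite mulrA quad_char_sq1 ?mul1r // subr_eq0.
Qed.

(** The involution x -> c/x preserves the phase and flips the sign of eta. *)
Lemma salie_nonsquare c : eta c = -1 -> salie psi c = 0.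
Proof.
move=> ec; have c0 : c != 0.
  by apply: contra_eq_neq ec => ->; rewrite quad_char0 eq_sym oppr_eq0 oner_eq0.
have invo : involutive (fun x : F => c / x).
  by move=> x; rewrite invf_div mulrC divfK.
have SN : salie psi c = - salie psi c.
  rewrite {1}/salie (reindex_inj (inv_inj invo)) /=.
  rewrite /salie -sumrN; apply: eq_big => [x|x x0].
    by rewrite mulf_eq0 invr_eq0 negb_or c0.
  by rewrite quad_charM // quad_charV // ec invf_div mulrCA divff // mulr1 addrC mulN1r mulNr.
have : salie psi c *+ 2 == 0 by rewrite mulr2n {1}SN addNr.
by rewrite mulrn_eq0 => /eqP.
Qed.

Lemma salie0 : salie psi 0 = gauss_sum psi.
Proof.
rewrite /gauss_sum (bigD1 0) //= quad_char0 mul0r add0r.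
by apply: eq_bigr => x _; rewrite mul0r addr0.
Qed.

Lemma salie_bound c : `|salie psi c| ^+ 2 <= 4 * q.
Proof.
have [->|c0] := eqVneq c 0.
  by rewrite salie0 gauss_sum_norm // ler_peMl ?ler0n // ler1n.
have [ec|ec] := quad_char_cases c0; last first.
  by rewrite salie_nonsquare // normr0 expr0n mulr_ge0 ?ler0n.
have [e ce] := quad_char1_sqr oddF ec.
have e0 : e != 0 by move: c0; rewrite ce expf_eq0.
rewrite ce salie_sqr // normrM exprMn gauss_sum_norm // ler_wpM2r ?ler0n //.
rewrite (_ : 4 = 2 ^+ 2) ?ler_pXn2r ?nnegrE ?normr_ge0 ?ler0n //; last by ring.
by rewrite (le_trans (ler_normD _ _)) // !add_char_norm.
Qed.

End Salie.

(** * Stepanov's method *)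

(** With r = (R+1)/2, this is the exponent identity D^((R^2-1)/2) D^r = (D^r)^R used in
    [stepanov_count]. *)
Lemma half_sqr_pred n : odd n -> ((n ^ 2).-1./2 + n.+1./2 = n.+1./2 * n)%N.
Proof.
move=> oddn; rewrite -(odd_double_half n) oddn add1n; set k := n./2.
have -> : (((k.*2.+1) ^ 2).-1 = (2 * (k * k.+1)).*2)%N by rewrite -mulnn; lia.
by rewrite -doubleS !doubleK; lia.
Qed.

Lemma size_polyM_le (A : nzSemiRingType) (p q : {poly A}) m n :
  leq (size p) m.+1 -> leq (size q) n -> leq (size (p * q)) (m + n).
Proof.
move=> pm qn; apply: leq_trans (size_polyMleq p q) _.
by move: (size p) (size q) pm qn; lia.
Qed.

Section BaseExpansion.

Variable L : idomainType.
Implicit Types (p : {poly L}) (P : {poly {poly L}}).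

(** [P] is read as a polynomial in z over polynomials in y; [n] bounds its degree in y. *)
Definition coef_size_le n P := forall k, leq (size P`_k) n.+1.

Lemma coef_size_leD m P P' :
  coef_size_le m P -> coef_size_le m P' -> coef_size_le m (P + P').
Proof.
by move=> Pm P'm k; rewrite coefD (leq_trans (size_polyD _ _)) // geq_max Pm P'm.
Qed.

Lemma coef_size_leN m P : coef_size_le m P -> coef_size_le m (- P).
Proof. by move=> Pm k; rewrite coefN size_polyN. Qed.

Lemma coef_size_leM m n P P' :
  coef_size_le m P -> coef_size_le n P' -> coef_size_le (m + n) (P * P').
Proof.
move=> Pm P'n k; rewrite coefM (leq_trans (size_sum _ _ _)) //.
apply/bigmax_leqP => i _; by rewrite -addnS size_polyM_le.
Qed.

Lemma coef_size_le_leq m n P : (m <= n)%N -> coef_size_le m P -> coef_size_le n P.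
Proof. by move=> mn Pm k; apply: leq_trans (Pm k) _. Qed.

(** Uniqueness of digits in base X^(n+1): coefficients of degree at most n do not overlap after the
    substitution. *)
Lemma base_Xn_inj n P : coef_size_le n P -> P.['X^(n.+1)] = 0 -> P = 0.
Proof.
elim/poly_ind: P => [//|P c IHP] Pn; rewrite hornerMXaddC addrC => eq0.
have cn : (size c <= n.+1)%N by have := Pn 0%N; rewrite coefD coefMX coefC add0r.
have c0 : c = 0 by rewrite -(take_polyDMXn P.['X^(n.+1)] cn) eq0 take_poly0r.
rewrite c0 addr0 IHP ?mul0r // => [k|].
  by have := Pn k.+1; rewrite coefD coefMX coefC addr0.
by rewrite -(drop_polyDMXn P.['X^(n.+1)] cn) eq0 drop_poly0r.
Qed.

End BaseExpansion.

Section FrobeniusPower.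

Variables (A : comNzRingType) (n : nat).
Hypothesis charn : [pchar A].-nat n.

Lemma pnat_pchar_gt0 : (0 < n)%N. Proof. by case/andP: charn. Qed.

Lemma expr_sum_pchar (I : Type) (r : seq I) (P : pred I) (f : I -> A) :
  (\sum_(i <- r | P i) f i) ^+ n = \sum_(i <- r | P i) f i ^+ n.
Proof.
apply: (big_morph (fun x => x ^+ n)) => [x y|]; first exact: exprDn_pchar.
by rewrite expr0n gtn_eqF // pnat_pchar_gt0.
Qed.

End FrobeniusPower.

Section Stepanov.

Variables (L : finFieldType) (R : nat).
Hypotheses (oddR : odd R) (charR : [pchar L].-nat R) (cardL : #|L| = (R ^ 2)%N).
Variables (D : {poly L}) (d : nat).
Hypothesis sizeD : size D = d.+1.
Hypothesis nonsqD : forall (a b : {poly L}) k,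
  k != 0 -> b != 0 -> a ^+ 2 <> k *: (D * b ^+ 2).
Variables I J : nat.

Local Notation r := (R.+1)./2.

Let charRp : [pchar {poly L}].-nat R.
Proof. by rewrite (eq_pnat R (@pchar_poly L)). Qed.

(** A polynomial of degree below [I] in y and below [J] in z is encoded by a matrix, so that such
    polynomials can be counted. *)
Definition bivar (e : 'M[L]_(J, I)) : {poly {poly L}} :=
  \sum_(j < J) (rVpoly (row j e))%:P * 'X^j.

Lemma bivar_coef e (j : 'I_J) : (bivar e)`_j = rVpoly (row j e).
Proof.
rewrite coef_sum (bigD1 j) //= coefCM coefXn eqxx mulr1 big1 ?addr0 // => i ij.
by rewrite coefCM coefXn eq_sym val_eqE (negbTE ij) mulr0.
Qed.

Lemma bivar_coef_size e : (0 < I)%N -> coef_size_le I.-1 (bivar e).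
Proof.
move=> I0 k; rewrite prednK //; have [kJ|kJ] := ltnP k J.
  by rewrite -[k]/(val (Ordinal kJ)) bivar_coef size_poly.
rewrite coef_sum big1 ?size_poly0 // => i _.
by rewrite coefCM coefXn gtn_eqF ?mulr0 // (leq_trans _ kJ).
Qed.

Lemma bivar_eq0 e : bivar e = 0 -> e = 0.
Proof.
move=> e0; apply/row_matrixP => j; rewrite row0 -[LHS]rVpolyK -bivar_coef e0.
by rewrite coef0 linear0.
Qed.

Definition poly_frob : {poly {poly L}} := \poly_(i < size D) (D`_i ^+ R)%:P.

Lemma poly_frobE : poly_frob.['X^R] = D ^+ R.
Proof.
rewrite horner_poly -[in RHS](coefK D) poly_def expr_sum_pchar //.
apply: eq_bigr => i _; rewrite exprZn -exprM mulnC exprM.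
by rewrite -mul_polyC.
Qed.

Let D0 : D != 0. Proof. by rewrite -size_poly_gt0 sizeD. Qed.

(* Viewed in two variables y and z = y^R, a vanishing auxiliary polynomial would give
   P^2 = D(y) D^R(z) P'^2; compare leading coefficients in z. *)
Lemma auxiliary_neq0 (e e' : 'M[L]_(J, I)) :
  (0 < I)%N -> (d + I.*2 <= R.+1)%N -> (e != 0) || (e' != 0) ->
  (bivar e).['X^R] + D ^+ r * (bivar e').['X^R] != 0.
Proof.
move=> I0 dI nz; apply/eqP => /eqP; rewrite addr_eq0 => /eqP eqP'.
set P := bivar e in eqP' *; set P' := bivar e' in eqP' *.
have PI := bivar_coef_size e I0; have P'I := bivar_coef_size e' I0.
have R0 := pnat_pchar_gt0 charR.
have G0 : P ^+ 2 - D%:P * poly_frob * P' ^+ 2 = 0.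
  (* By [dI], the degree in y is at most d + 2(I - 1) <= R - 1, so the digits in base X^R are
     unique. *)
  apply: (@base_Xn_inj _ R.-1); rewrite ?prednK //.
    apply: (@coef_size_le_leq _ (d + (I.-1 + I.-1))); first by lia.
    apply: coef_size_leD.
      apply: (@coef_size_le_leq _ (I.-1 + I.-1)); first by lia.
      exact: coef_size_leM.
    apply: coef_size_leN; apply: coef_size_leM; last exact: coef_size_leM.
    rewrite -[d]addn0; apply: coef_size_leM => k.
      by rewrite coefC; case: ifP => _; rewrite ?size_poly0 ?sizeD.
    rewrite coef_poly; case: ifP => _; rewrite ?size_poly0 //.
    exact: size_polyC_leq1.
  rewrite hornerD hornerN horner_exp hornerM horner_exp hornerM hornerC eqP'.
  rewrite poly_frobE sqrrN exprMn -exprM muln2.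
  have -> : (r.*2 = R.+1)%N by move: oddR; lia.
  by rewrite exprS subrr.
have leadfrob : lead_coef poly_frob = (lead_coef D ^+ R)%:P.
  by rewrite lead_coef_poly ?size_poly_gt0 // polyC_eq0 expf_neq0 // lead_coef_eq0.
have := congr1 lead_coef (subr0_eq G0).
rewrite lead_coef_exp lead_coefM lead_coef_exp lead_coefM lead_coefC leadfrob.
have [P'0|P'0] := eqVneq P' 0.
  rewrite P'0 lead_coef0 expr0n mulr0 => /eqP.
  rewrite expf_eq0 lead_coef_eq0 /= => /eqP /bivar_eq0 e0.
  by move: nz; rewrite e0 (bivar_eq0 P'0) eqxx.
rewrite [D * _]mulrC -mulrA mul_polyC; apply: nonsqD.
  by rewrite expf_neq0 // lead_coef_eq0.
by rewrite lead_coef_eq0.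
Qed.

(* Where y^(R^2) = y, its value is the R-th power of that of [bivar e] at (y, y^R); this is
   how a low-degree identity forces a high-degree polynomial to vanish at many points. *)
Definition bivar_frob (e : 'M[L]_(J, I)) : {poly L} :=
  \sum_(j < J) rVpoly (row j e) ^+ R * 'X^j.

Lemma bivar_frobB e e' : bivar_frob (e - e') = bivar_frob e - bivar_frob e'.
Proof.
rewrite -sumrB; apply: eq_bigr => j _.
by rewrite !linearB /= exprDn_pchar // exprNn_pchar // mulrBl.
Qed.

Lemma size_bivar_frob e : (size (bivar_frob e) <= I.-1 * R + J)%N.
Proof.
rewrite (leq_trans (size_sum _ _ _)) //; apply/bigmax_leqP => j _.
rewrite (leq_trans (size_polyMleq _ _)) // size_polyXn.
rewrite addnS /= (leq_trans _ (_ : (I.-1 * R).+1 + j <= _)%N) //; last first.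
  by rewrite addSn -addnS leq_add2l ltn_ord.
rewrite leq_add2r (leq_trans (size_poly_exp_leq _ _)) // ltnS leq_mul2r.
by rewrite -!subn1 leq_sub2r ?orbT //; exact: size_poly.
Qed.

Lemma bivar_frob_horner e y : (bivar e).['X^R].[y] ^+ R = (bivar_frob e).[y].
Proof.
rewrite /bivar /bivar_frob !horner_sum expr_sum_pchar //.
apply: eq_bigr => j _; rewrite !hornerM hornerC !hornerXn !horner_exp hornerX.
by rewrite exprMn -!exprM mulnAC mulnn -cardL exprM expf_card.
Qed.

(** The map is additive in the pair but only Frobenius-semilinear, so elements are counted instead
    of dimensions: two of the |L|^(2IJ) pairs share one of at most |L|^N images, and their
    difference is a nonzero kernel element. *)
Lemma pigeonhole_kernel eps : (I.-1 * R + J + d * r < 2 * (I * J))%N ->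
  exists e e', ((e != 0) || (e' != 0)) /\
    bivar_frob e + eps *: (D ^+ r * bivar_frob e') = 0.
Proof.
set N := (_ + _ + _)%N => Nlt.
pose phi (x : 'M[L]_(J, I) * 'M[L]_(J, I)) : {poly L} :=
  bivar_frob x.1 + eps *: (D ^+ r * bivar_frob x.2).
have sphi x : (size (phi x) <= N)%N.
  rewrite (leq_trans (size_polyD _ _)) // geq_max.
  rewrite (leq_trans (size_bivar_frob _)) ?leq_addr //=.
  rewrite (leq_trans (size_scale_leq _ _)) // /N addnC size_polyM_le ?size_bivar_frob //.
  by have := size_poly_exp_leq D r; rewrite sizeD.
have /injectivePn[x [y xy /(congr1 rVpoly)]] :
    ~~ injectiveb (fun x => poly_rV (phi x) : 'rV[L]_N).
  apply/injectiveP => /leq_card; rewrite card_prod !card_mx -expnD mul1n leq_exp2l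
    ?finNzRing_gt1 //.
  by rewrite leqNgt mulnC addnn -mul2n Nlt.
rewrite !poly_rV_K // => exy.
exists (x.1 - y.1), (x.2 - y.2); split.
  rewrite !subr_eq0 -negb_and; apply: contra xy => /andP[/eqP x1 /eqP x2].
  by apply/eqP; case: x y x1 x2 {exy} => [? ?] [? ?] /= -> ->.
by rewrite !bivar_frobB mulrBr scalerBr addrACA -opprD; apply/eqP; rewrite subr_eq0; apply/eqP; exact: exy.
Qed.

(** The auxiliary polynomial [h] is nonzero, and at each point of the set its R-th power equals the
    value of the combination annihilated by [pigeonhole_kernel]. Its size therefore bounds the
    number of points. *)
Lemma stepanov_count (eps : L) :
  (0 < I)%N -> (d + I.*2 <= R.+1)%N -> (I.-1 * R + J + d * r < 2 * (I * J))%N ->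
  (#|[set y | (D.[y] == 0%R) || (D.[y] ^+ (#|L|.-1)./2 == eps)]| <=
     I + J * R + d * r)%N.
Proof.
move=> I0 dI NIJ; have [e [e' [nz ker]]] := pigeonhole_kernel eps NIJ.
have h0 := auxiliary_neq0 I0 dI nz; set h := _ + _ in h0.
have sbiv e1 : (size (bivar e1).['X^R] <= I + J * R)%N.
  rewrite /bivar horner_sum (leq_trans (size_sum _ _ _)) //.
  apply/bigmax_leqP => j _; rewrite hornerM hornerC hornerXn -exprM.
  rewrite (leq_trans (size_polyMleq _ _)) // size_polyXn addnS /=.
  by rewrite leq_add ?size_poly // mulnC leq_mul2r (ltnW (ltn_ord j)) orbT.
have sh : (size h <= I + J * R + d * r)%N.
  rewrite (leq_trans (size_polyD _ _)) // geq_max.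
  rewrite (leq_trans (sbiv _)) ?leq_addr //= addnC size_polyM_le ?sbiv //.
  by have := size_poly_exp_leq D r; rewrite sizeD.
apply: leq_trans sh; rewrite cardE ltnW //; apply: max_poly_roots; rewrite ?enum_uniq //.
apply/allP => y; rewrite mem_enum inE => Dy; rewrite /root.
have R0 := pnat_pchar_gt0 charR.
suff : h.[y] ^+ R = (bivar_frob e + eps *: (D ^+ r * bivar_frob e')).[y].
  by rewrite ker horner0 => /eqP; rewrite expf_eq0 => /andP[].
rewrite /h 2!hornerD [in LHS]hornerM exprDn_pchar // exprMn !bivar_frob_horner.
rewrite hornerZ hornerM mulrA; congr (_ + _ * _); rewrite !horner_exp.
have r0 : (0 < r)%N by move: R0; lia.
case/orP: Dy => [/eqP ->|/eqP <-].
  by rewrite ![0 ^+ r]expr0n gtn_eqF // expr0n gtn_eqF // mulr0.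
rewrite -exprM -exprD cardL; congr (_ ^+ _).
by rewrite half_sqr_pred.
Qed.

End Stepanov.

(* Such an equality makes g^2 - c a square up to a constant: (h - l g)(h + l g) = const. *)
Lemma pell_nonsquare (L : fieldType) (g a b : {poly L}) (c k : L) :
  (2 : L) != 0 -> g \is monic -> (1 < size g)%N -> c != 0 -> k != 0 -> b != 0 ->
  a ^+ 2 <> k *: ((g ^+ 2 - c%:P) * b ^+ 2).
Proof.
move=> two0 gmon gsize c0 k0 b0 eqab.
have /dvdpP[h ah] : b %| a.
  by rewrite -(dvdp_pexp2r _ _ (ltn0Sn 1)) eqab dvdpZr // dvdp_mull.
have h2 : h ^+ 2 = k *: (g ^+ 2 - c%:P).
  by apply: (mulIf (expf_neq0 2 b0)); rewrite -exprMn -ah eqab scalerAl.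
have size_g2 : (1 < size (g ^+ 2))%N.
  by rewrite size_monicM ?monic_neq0 //; move: (size g) gsize => s; lia.
have kl : k = lead_coef h ^+ 2.
  rewrite -lead_coef_exp h2 lead_coefZ lead_coefDl ?lead_coef_exp ?(monicP gmon) ?expr1n ?mulr1 //.
  by rewrite size_polyN (leq_ltn_trans (size_polyC_leq1 _)).
set l := lead_coef h in kl.
have prod : (h - l *: g) * (h + l *: g) = (- (k * c))%:P.
  rewrite -subr_sqr h2 exprZn -kl scalerBr addrAC subrr add0r.
  by rewrite -mul_polyC -polyCM polyCN.
have kc0 : (- (k * c))%:P != 0 :> {poly L} by rewrite polyC_eq0 oppr_eq0 mulf_neq0.
have := kc0; rewrite -prod mulf_eq0 negb_or => /andP[n1 n2].
have := congr1 (fun p : {poly L} => size p) prod.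
rewrite /= size_mul // size_polyC oppr_eq0 mulf_neq0 //= => sz.
have [s1 s2] : leq (size (h - l *: g)) 1 /\ leq (size (h + l *: g)) 1.
  rewrite -!size_poly_gt0 in n1 n2.
  by move: (size _) (size _) n1 n2 sz => u v; lia.
have l0 : l != 0 by apply: contraNneq k0 => l0; rewrite kl l0 expr0n.
(* Both factors are constant, hence so is their difference 2 l g, against the degree of g. *)
have : leq (size ((2 * l) *: g)) 1.
  have -> : (2 * l) *: g = (h + l *: g) - (h - l *: g).
    by rewrite opprB addrC addrA subrK mulr_natl -scalerMnl mulr2n.
  by rewrite (leq_trans (size_polyD _ _)) // size_polyN geq_max s2.
by rewrite size_scale ?mulf_neq0 // leqNgt gsize.
Qed.

(** * Stepanov's bound for quadratic character sums and Kloosterman sums *)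

Section QuadCharSum.

Variables (L : finFieldType) (R q : nat).
Hypotheses (oddR : odd R) (charR : [pchar L].-nat R) (cardL : #|L| = (R ^ 2)%N).
Hypotheses (q_gt1 : (1 < q)%N) (qR : (2 * q ^ 2 + 2 * q < R)%N).

Local Notation eta := (@quad_char L).

Let oddL : odd #|L|. Proof. by rewrite cardL oddX oddR. Qed.

Section FixedPolynomial.

Variable D : {poly L}.
Hypothesis sizeD : size D = (q.*2).+1.
Hypothesis nonsqD : forall (a b : {poly L}) k,
  k != 0 -> b != 0 -> a ^+ 2 <> k *: (D * b ^+ 2).

Let S eps : {set L} :=
  [set y | (D.[y] == 0) || (D.[y] ^+ (#|L|.-1)./2 == eps)].

(* I is the largest value allowed by [2q + 2I <= R + 1]; J then gives more unknowns than
   equations. *)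
Let card_S eps : (2 * #|S eps| <= R ^ 2 + (4 * q + 3) * R)%N.
Proof.
have := @stepanov_count L R oddR charR cardL D q.*2 sizeD nonsqD
  ((R.+1)./2 - q) ((R.+1)./2 + q) eps; rewrite -/(S eps).
move: #|S eps| => n; move: oddR qR => oR.
rewrite -(odd_double_half R) oR add1n; move: R./2 => k; rewrite -doubleS doubleK -!mulnn.
move=> qk; have [m km] : exists m, k = (q + m)%N.
  by exists (k - q)%N; rewrite subnKC //; lia.
rewrite {}km in qk *; rewrite -addnS addKn => bnd.
have {bnd} : (n <= m.+1 + (q + m.+1 + q) * (q + m).*2.+1 + q.*2 * (q + m.+1))%N.
  (* With R = 2(q + m) + 1, there are more unknowns than equations exactly when 2 q^2 < 2 m + 1,
     which is [qR]. *)
  by apply: bnd => //=; lia.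
lia.
Qed.

(** The sum is the difference of the sizes of [S 1] and [S (-1)], in which the common zeros of [D]
    cancel. As the two sets cover L, the upper bound on each is also a lower bound on the other. *)
Lemma quad_char_poly_sum : `|\sum_y eta D.[y]| <= ((4 * q + 3) * R)%:R.
Proof.
have SE : \sum_y eta D.[y] = #|S 1|%:R - #|S (-1)|%:R.
  have cardE1 eps : #|S eps|%:R = \sum_y (y \in S eps)%:R :> algC.
    rewrite -sum1_card natr_sum big_mkcond /=; apply: eq_bigr => y _.
    by case: (y \in _).
  rewrite !cardE1 -sumrB; apply: eq_bigr => y _.
  rewrite !inE /quad_char; have [_|D0] /= := eqVneq D.[y] 0; first by rewrite subrr.
  have /orP[/eqP ->|/eqP ->] := expf_half_card oddL D0.
    by rewrite eqxx (negbTE (one_neqN1 oddL)) subr0.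
  by rewrite eqxx eq_sym (negbTE (one_neqN1 oddL)) sub0r.
have cover : (R ^ 2 <= #|S 1%R| + #|S (-1)%R|)%N.
  rewrite -cardL -cardsT -cardsUI; apply: leq_trans (leq_addr _ _).
  apply/subset_leq_card/subsetP => y _; rewrite !inE.
  have [//|D0] := eqVneq D.[y] 0; exact: expf_half_card.
rewrite SE real_ler_norml ?realB ?realn // lerNl opprB.
have := card_S 1; have := card_S (-1); move: #|S 1| #|S (-1)| cover => m n.
by move=> c h1 h2; rewrite !lerBlDr -!natrD !ler_nat; lia.
Qed.

End FixedPolynomial.

(* psi kills all y^q - y, so the sum over v may be averaged over the shifts v + y^q - y. *)
Lemma kloosterman_stepanov (psi : L -> algC) c :
  add_char psi -> (forall y, psi (y ^+ q) = psi y) -> c != 0 ->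
  `|kloosterman psi c| <= ((4 * q + 3) * R)%:R.
Proof.
move=> psiP psi_q c0; have [psiD psi0 _] := psiP.
pose D v : {poly L} := ('X^q - 'X + v%:P) ^+ 2 - (4 * c)%:P.
have size_tl v : (size (- 'X + v%:P : {poly L})%R < q.+1)%N.
  rewrite (leq_ltn_trans (size_polyD _ _)) // size_polyN size_polyX gtn_max ltnS q_gt1.
  by rewrite (leq_ltn_trans (size_polyC_leq1 _)) // ltnS ltnW.
have size_g v : size ('X^q - 'X + v%:P : {poly L}) = q.+1.
  by rewrite -addrA size_polyDl size_polyXn.
have mon_g v : 'X^q - 'X + v%:P \is @monic L.
  by rewrite monicE -addrA lead_coefDl ?lead_coefXn ?size_polyXn.
have two0 := odd_card_two_neq0 oddL.
have c40 : 4 * c != 0.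
  by rewrite mulf_neq0 // (_ : 4 = 2 * 2) ?mulf_neq0 //; ring.
have size_D v : size (D v) = q.*2.+1.
  have size_g2 : size (('X^q - 'X + v%:P : {poly L}) ^+ 2) = q.*2.+1.
    by rewrite size_monicM ?monic_neq0 // size_g addSn /= addnS addnn.
  by rewrite size_polyDl // size_g2 size_polyN (leq_ltn_trans (size_polyC_leq1 _)) //
    ltnS double_gt0 ltnW.
have nonsq v a b k : k != 0 -> b != 0 -> a ^+ 2 <> k *: (D v * b ^+ 2).
  by move=> k0 b0; apply: pell_nonsquare; rewrite // size_g ltnS ltnW.
have avg y : kloosterman psi c = \sum_v psi v * eta (D v).[y].
  rewrite kloosterman_quad_char // (reindex_inj (addIr (y ^+ q - y))) /=.
  apply: eq_bigr => v _; rewrite psiD [psi (_ - _)]psiD psi_q -psiD subrr psi0 mulr1.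
  congr (_ * eta _); rewrite /D hornerD hornerN horner_exp 2!hornerD hornerN hornerXn hornerX
    !hornerC.
  by rewrite [v + _]addrC.
have card0 : 0 < #|L|%:R :> algC by rewrite ltr0n ltnW // finNzRing_gt1.
rewrite -(ler_pM2l card0) -[X in X * `|_|]normr_nat -normrM.
have -> : #|L|%:R * kloosterman psi c = \sum_v psi v * \sum_y eta (D v).[y].
  rewrite mulr_natl -sumr_const (eq_bigr _ (fun y _ => avg y)) exchange_big.
  by apply: eq_bigr => v _; rewrite mulr_sumr.
rewrite (le_trans (ler_norm_sum _ _ _)) // mulr_natl -sumr_const ler_sum // => v _.
rewrite normrM add_char_norm // mul1r; apply: quad_char_poly_sum => //.
exact: nonsq.
Qed.

End QuadCharSum.

(** * Kloosterman sums in quadratic towers *)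

Lemma sum_fiber_cond (T S : finType) (p : pred S) (g : T -> S) (f : S -> algC) :
  \sum_(x | p (g x)) f (g x) = \sum_(v | p v) f v * #|[set x | g x == v]|%:R.
Proof.
rewrite (partition_big g p) //=; apply: eq_bigr => v pv.
rewrite (eq_bigr (fun=> f v)) => [|x /andP[_ /eqP ->] //].
rewrite sumr_const mulr_natr; congr (_ *+ _); apply: eq_card => x.
by rewrite !inE unfold_in andbC; case: eqP => // ->.
Qed.

Section QuadraticExtension.

Variable F : finFieldType.
Hypothesis oddF : odd #|F|.
Local Notation eta := (@quad_char F).

(** A square root [w] of a nonsquare is adjoined; coordinates along 1 and [w] make trace and norm
    explicit. *)
Lemma quadratic_extension : exists (L : finFieldType) (iota : {rmorphism F -> L})
    (w : L) (nu : F),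
  [/\ #|L| = (#|F| ^ 2)%N, eta nu = -1, w ^+ 2 = iota nu &
      bijective (fun xy : F * F => iota xy.1 + iota xy.2 * w)].
Proof.
have [nu enu] := exists_nonsquare oddF.
have nsq x : x ^+ 2 != nu.
  apply: contra_eq_neq enu => <-; have [->|x0] := eqVneq x 0.
    by rewrite expr0n quad_char0 eq_sym oppr_eq0 oner_eq0.
  by rewrite quad_char_sqr // eq_sym eqNr oner_eq0.
pose h : {poly F} := 'X^2 - nu%:P.
have size_h : size h = 3%N by rewrite size_XnsubC.
have mon_h : h \is monic by rewrite monicXnsubC.
have irr_h : irreducible_poly h.
  apply: cubic_irreducible; rewrite ?size_h // => x.
  by rewrite /root hornerD hornerN hornerXn hornerC subr_eq0.
have mi : monic_irreducible_poly h by [].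
pose L : finFieldType := {poly %/ h with mi}.
pose iota : {rmorphism F -> L} := qpolyC h.
pose w : L := in_qpoly h 'X.
have cardL : #|L| = (#|F| ^ 2)%N by rewrite card_qfpoly size_h.
have w2 : w ^+ 2 = iota nu.
  have -> : iota nu = in_qpoly h nu%:P.
    apply/val_inj; rewrite /= [RHS]in_qpoly_small ?qpolyCE //.
    by rewrite (mk_monicE mi) size_h (leq_ltn_trans (size_polyC_leq1 _)).
  have h0 : in_qpoly h h = 0.
    by apply/val_inj; rewrite /= (mk_monicE mi) Pdiv.RingMonic.rmodpp.
  have -> : nu%:P = 'X^2 - h by rewrite opprB addrC subrK.
  by rewrite rmorphB /= h0 subr0 rmorphXn.
exists L, iota, w, nu; split=> //.
apply: inj_card_bij; last by rewrite card_prod cardL.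
move=> [x y] [x' y'] /= exy.
have [yy|yy] := eqVneq y y'.
  by rewrite yy in exy *; move/addIr/fmorph_inj: exy => ->.
(* Two representations with distinct second coordinates would place [w] in the base field and make
   [nu] a square. *)
have : w = iota ((x - x') / (y' - y)).
  rewrite fmorph_div !rmorphB /=; apply: (canRL (mulfK _)).
    by rewrite -rmorphB fmorph_eq0 subr_eq0 eq_sym.
  rewrite mulrC mulrBl; apply/eqP.
  by rewrite subr_eq addrAC exy addrAC subrr add0r.
move/(congr1 (fun z => z ^+ 2)); rewrite w2 -rmorphXn => /fmorph_inj nuE.
by have := nsq ((x - x') / (y' - y)); rewrite -nuE eqxx.
Qed.

Section Doubling.

Variable psi : F -> algC.
Hypothesis psiP : add_char psi.
Local Notation q := (#|F|%:R : algC).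

Let psiD : {morph psi : x y / x + y >-> x * y}. Proof. by case: psiP. Qed.
Let psi0 : psi 0 = 1. Proof. by case: psiP. Qed.
Let two0 := odd_card_two_neq0 oddF.
Let four0 : (4 : F) != 0.
Proof. by rewrite (_ : 4 = 2 * 2) ?mulf_neq0 //; ring. Qed.

(* (x, y) is counted by its sum s and product n; in the quadratic extension, trace and norm
   play the same role, with the opposite sign of the quadratic character. *)
Lemma kloosterman_sqr c : c != 0 ->
  kloosterman psi c ^+ 2 =
  \sum_s \sum_(n | n != 0) psi (s + c * s / n) * (1 + eta (s ^+ 2 - 4 * n)).
Proof.
move=> c0; rewrite expr2 /kloosterman big_distrlr /= pair_big_dep /=.
rewrite (reindex_onto (fun p : F * F => (p.2, p.1 - p.2)) (fun p => (p.1 + p.2, p.1))) /=;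
  last by move=> [x y] _; rewrite /= addrC addKr.
rewrite (eq_bigl (fun p : F * F => p.2 * (p.1 - p.2) != 0)); last first.
  move=> [s x] /=; have -> : x + (s - x) = s by ring.
  by rewrite eqxx andbT mulf_eq0 negb_or.
rewrite (eq_bigr (fun p : F * F => psi (p.1 + c * p.1 / (p.2 * (p.1 - p.2)))));
  last first.
  move=> [s x] /=; rewrite mulf_eq0 negb_or => /andP[x0 sx0].
  by rewrite -psiD; congr psi; field; rewrite x0 sx0.
rewrite -(pair_big_dep predT (fun s x => x * (s - x) != 0)
  (fun s x => psi (s + c * s / (x * (s - x))))) /=.
apply: eq_bigr => s _.
rewrite (sum_fiber_cond (fun n => n != 0) (fun x => x * (s - x))
  (fun n => psi (s + c * s / n))).
apply: eq_bigr => n _; rewrite -card_quad_roots //; congr (_ * _%:R).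
apply: eq_card => x; rewrite !inE -subr_eq0 -oppr_eq0; congr (_ == 0); ring.
Qed.

(** Sorting by trace and norm gives the double sum of [kloosterman_sqr] with 1 - eta for 1 + eta.
    Adding the two removes eta, and orthogonality leaves only n = -c, worth 2q. Invariance under
    n-th powers is carried along because [kloosterman_stepanov] averages over y^q - y. *)
Lemma kloosterman_double : exists (L : finFieldType) (iota : {rmorphism F -> L})
    (psi' : L -> algC),
  [/\ #|L| = (#|F| ^ 2)%N, add_char psi',
      forall n, odd n -> [pchar F].-nat n -> (forall x, psi (x ^+ n) = psi x) ->
        forall z, psi' (z ^+ n) = psi' z &
      forall c, c != 0 -> kloosterman psi' (iota c) = 2 * q - kloosterman psi c ^+ 2].
Proof.
have [L [iota [w [nu [cardL enu w2 [g gK fK]]]]]] := quadratic_extension.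
set f := (fun xy => _) in gK fK.
have nu0 : nu != 0.
  by apply: contra_eq_neq enu => ->; rewrite quad_char0 eq_sym oppr_eq0 oner_eq0.
have fD a b : f (a + b) = f a + f b.
  by rewrite /f /= !rmorphD mulrDl addrACA.
have gD u v : g (u + v) = g u + g v.
  by apply: (can_inj gK); rewrite fD !fK.
(* The trace of x + y w is 2x. *)
pose psi' z := psi (2 * (g z).1).
exists L, iota, psi'; split=> //.
- split=> [u v||].
  + by rewrite /psi' gD mulrDr psiD.
  + have /eqP : g 0 + g 0 = g 0 + 0 by rewrite -gD !addr0.
    by rewrite (inj_eq (addrI _)) /psi' => /eqP ->; rewrite mulr0.
  + have [_ _ [x x1]] := psiP; exists (f (x / 2, 0)).
    by rewrite /psi' gK /= mulrC divfK.
- move=> n oddn charn psin z; rewrite -[z]fK; set p := g z.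
  have charLn : [pchar L].-nat n by rewrite (eq_pnat n (fmorph_pchar iota)).
  (* As n is odd, w^n is a multiple of w by an element of the base field, so the first coordinate is
     merely raised to the power n. *)
  have -> : f p ^+ n = f (p.1 ^+ n, p.2 ^+ n * nu ^+ n./2).
    have wn : w ^+ n = (w ^+ 2) ^+ n./2 * w.
      by rewrite -{1}(odd_double_half n) oddn exprD expr1 mulrC -exprM mul2n.
    by rewrite /f exprDn_pchar // exprMn wn w2 !rmorphM !rmorphXn /= mulrA.
  rewrite /psi' !gK /= -[RHS]psin exprMn; congr (psi (_ * _)).
  have -> : (2 : F) = 1 + 1 by ring.
  by rewrite exprDn_pchar // expr1n.
move=> c c0; pose N (p : F * F) := p.1 ^+ 2 - nu * p.2 ^+ 2.
have fN (p : F * F) : f p * f (p.1, - p.2) = iota (N p).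
  by rewrite /f /N /= rmorphB rmorphXn rmorphM rmorphXn rmorphN /= -w2; ring.
have f0 p : (f p == 0) = (p == 0).
  have -> : 0 = f 0 by rewrite /f /= !rmorph0 mul0r addr0.
  by rewrite (inj_eq (can_inj gK)).
have N0 p : (f p != 0) = (N p != 0).
  rewrite -(fmorph_eq0 iota) -fN mulf_eq0 !f0 negb_or.
  by case: p => x y; rewrite /= -[(x, y) == 0]/((x == 0) && (y == 0))
    -[(x, - y) == 0]/((x == 0) && (- y == 0)) oppr_eq0 andbb.
have KL : kloosterman psi' (iota c) =
    \sum_s \sum_(n | n != 0) psi (s + c * s / n) * (1 - eta (s ^+ 2 - 4 * n)).
  rewrite /kloosterman (reindex f) /=; last by exists g.
  rewrite (eq_bigl (fun p => N p != 0)) //.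
  rewrite (eq_bigr (fun p : F * F => psi (2 * p.1 + c * (2 * p.1) / N p))); last first.
    move=> p Np; have Np' : f p != 0 by rewrite N0.
    have -> : f p + iota c / f p = f (p.1 + c * p.1 / N p, p.2 - c * p.2 / N p).
      have -> : iota c / f p = iota (c / N p) * f (p.1, - p.2).
        rewrite fmorph_div -fN invfM mulrA divfK //.
        by move: Np; rewrite -(fmorph_eq0 iota) -fN mulf_eq0 negb_or => /andP[].
      by rewrite /f /= !(rmorphD, rmorphB, rmorphM, rmorphN) /=; ring.
    by rewrite /psi' gK /=; congr psi; ring.
  rewrite (reindex (fun p : F * F => (p.1 / 2, p.2))) /=; last first.
    by exists (fun p => (2 * p.1, p.2)) => [] [x y] _ /=; congr (_, _); field.
  rewrite (eq_bigr (fun p : F * F => psi (p.1 + c * p.1 / N (p.1 / 2, p.2)))); last first.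
    by move=> [s y] _ /=; rewrite (_ : 2 * (s / 2) = s) //; field.
  rewrite -(pair_big_dep predT (fun s y => N (s / 2, y) != 0)
    (fun s y => psi (s + c * s / N (s / 2, y)))) /=.
  apply: eq_bigr => s _.
  rewrite (sum_fiber_cond (fun n => n != 0) (fun y => N (s / 2, y))
    (fun n => psi (s + c * s / n))).
  apply: eq_bigr => n _; congr (_ * _).
  (* Norm n and trace s mean y^2 = (s^2 - 4n)/(4 nu); the nonsquare [nu] reverses the sign of
     eta. *)
  have -> : 1 - eta (s ^+ 2 - 4 * n) = 1 + eta ((s ^+ 2 - 4 * n) / (2 ^+ 2 * nu)).
    rewrite quad_charM // quad_charV // quad_charM // quad_char_sqr // enu mul1r.
    by rewrite mulrN1.
  rewrite -card_sqrt //; congr _%:R; apply: eq_card => y; rewrite !inE /N /=.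
  rewrite -subr_eq0 -[RHS]subr_eq0.
  have -> : (s / 2) ^+ 2 - nu * y ^+ 2 - n =
    - nu * (y ^+ 2 - (s ^+ 2 - 4 * n) / (2 ^+ 2 * nu)) by field; rewrite nu0 four0 two0.
  by rewrite mulf_eq0 oppr_eq0 (negbTE nu0).
apply/eqP; rewrite eq_sym subr_eq kloosterman_sqr // KL -big_split /=; apply/eqP.
rewrite (eq_bigr (fun s => \sum_(n | n != 0) 2 * psi ((1 + c / n) * s))); last first.
  move=> s _; rewrite -big_split; apply: eq_bigr => n _ /=.
  have -> : s + c * s / n = (1 + c / n) * s by ring.
  by ring.
rewrite exchange_big (bigD1 (- c)) ?oppr_eq0 //=.
rewrite -mulr_sumr sum_add_char // invrN mulrN divff // subrr eqxx big1 ?addr0 //.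
move=> n /andP[n0 nc]; rewrite -mulr_sumr sum_add_char // ifN ?mulr0 //.
apply: contra nc => /eqP e; rewrite -addr_eq0; apply/eqP.
by rewrite -[RHS](mulr0 n) -e; field.
Qed.

End Doubling.

End QuadraticExtension.

Lemma sqr_lt_exp4 q : (1 < q)%N -> (2 * q ^ 2 + 2 * q < q ^ 4)%N.
Proof.
move=> q1; have h1 : (q * 2 <= q * q)%N by rewrite leq_mul2l q1 orbT.
have h2 : ((q * q) * 4 <= (q * q) * (q * q))%N.
  by rewrite leq_mul2l (leq_mul q1 q1) orbT.
rewrite (expnD q 2 2) -mulnn; move: h1 h2 q1.
by move: (q * q)%N => qq; move: (qq * qq)%N => qqqq; lia.
Qed.

(** With u = K^2/q, one doubling replaces u by (2 - u)^2, and (2 - u)^2 - 4 = u(u - 4): for u >= 4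
    the excess over 4 grows at least fourfold. The exponent [n] stays fixed along the tower. *)
Lemma kloosterman_tower (k n : nat) (F : finFieldType) (psi : F -> algC) (c : F) :
  odd #|F| -> add_char psi -> c != 0 -> odd n -> [pchar F].-nat n ->
  (forall x, psi (x ^+ n) = psi x) -> 4 <= kloosterman psi c ^+ 2 / #|F|%:R ->
  exists (L : finFieldType) (psi' : L -> algC) (c' : L),
  [/\ #|L| = (#|F| ^ (2 ^ k))%N, add_char psi', c' != 0, [pchar L].-nat n &
      forall x, psi' (x ^+ n) = psi' x] /\
      4 ^+ k * (kloosterman psi c ^+ 2 / #|F|%:R - 4) <=
        kloosterman psi' c' ^+ 2 / #|L|%:R - 4.
Proof.
elim: k F psi c => [|k IHk] F psi c oddF psiP c0 oddn charn psin u4.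
  by exists F, psi, c; rewrite mul1r.
have [L [iota [psi' [cardL psi'P psi'n KL]]]] := kloosterman_double oddF psiP.
have q0 : #|F|%:R != 0 :> algC by rewrite pnatr_eq0 -lt0n ltnW // finNzRing_gt1.
set u := _ / _ in u4 *.
have u' : kloosterman psi' (iota c) ^+ 2 / #|L|%:R = (2 - u) ^+ 2.
  by rewrite KL // cardL natrX /u; field.
have step : 4 * (u - 4) <= (2 - u) ^+ 2 - 4.
  have -> : (2 - u) ^+ 2 - 4 = u * (u - 4) by ring.
  by rewrite ler_wpM2r // subr_ge0.
have [|||| M [psi2 [c2 [[cardM psi2P c20 charM psi2n] le2]]]] :=
    IHk L psi' (iota c) _ psi'P _ oddn _ (psi'n n oddn charn psin) _.
- by rewrite cardL oddX.
- by rewrite fmorph_eq0.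
- by rewrite (eq_pnat n (fmorph_pchar iota)).
- by rewrite u' -subr_ge0 (le_trans _ step) // mulr_ge0 // subr_ge0.
exists M, psi2, c2; split; first by split=> //; rewrite cardM cardL -expnM -expnS.
by rewrite (le_trans _ le2) // u' exprSr -mulrA ler_wpM2l // exprn_ge0.
Qed.

Theorem kloosterman_bound (F : finFieldType) (psi : F -> algC) (c : F) :
  odd #|F| -> add_char psi -> kloosterman psi c ^+ 2 <= 4 * #|F|%:R.
Proof.
move=> oddF psiP; set q := #|F|; have q_gt1 : (1 < q)%N := finNzRing_gt1 F.
have q_gt0 : 0 < q%:R :> algC by rewrite ltr0n ltnW.
have [->|c0] := eqVneq c 0.
  have -> : kloosterman psi 0 = -1.
    have := sum_add_char1 psiP; rewrite (bigD1 0) //=; have [_ -> _] := psiP.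
    move/eqP; rewrite addrC addr_eq0 => /eqP <-.
    by apply: eq_bigr => x _; rewrite mul0r addr0.
  by rewrite sqrrN expr1n -natrM ler1n muln_gt0 (ltnW q_gt1).
rewrite -ler_pdivrMr //; set u := _ / _.
have realu : u \is Num.real by rewrite rpredM ?rpredX ?kloosterman_real ?rpredV ?realn.
rewrite real_leNgt ?realn //; apply/negP => u4.
have [p p_pr charF] := finPcharP F.
have cardF : q = (p ^ logn p q)%N := card_pprimeChar charF.
have charq : [pchar F].-nat q.
  by rewrite cardF pnatX (eq_pnat p (pcharf_eq charF)) pnat_id.
(* The square of Stepanov's constant; it depends on the bottom field only, not on the height of the
   tower. *)
pose B : algC := ((4 * q + 3) ^ 2)%:R.
(* [Num.bound] makes 4^k exceed B/(u - 4); the added 3 makes R at least q^4, as [sqr_lt_exp4]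
   requires. *)
pose k := (Num.bound (B / (u - 4)) + 3)%N.
have u40 : 0 < u - 4 by rewrite subr_gt0.
have [L [psi' [c' [[cardL psi'P c'0 charL psi'q] growth]]]] :=
  kloosterman_tower k oddF psiP c0 oddF charq (fun x => congr1 psi (expf_card x)) (ltW u4).
pose R := (q ^ (2 ^ k.-1))%N.
have cardLR : #|L| = (R ^ 2)%N.
  by rewrite cardL /R -expnM -expnSr prednK // /k addnS.
have qR : (2 * q ^ 2 + 2 * q < R)%N.
  apply: (@leq_trans (q ^ 4)%N); first exact: sqr_lt_exp4.
  rewrite /R leq_exp2l //; apply: (@leq_pexp2l 2 2) => //.
  by rewrite /k addnS leq_addl.
have oddR : odd R by rewrite oddX oddF orbT.
have charR : [pchar L].-nat R by rewrite pnatX charL.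
have := kloosterman_stepanov oddR charR cardLR q_gt1 qR psi'P psi'q c'0.
have R0 : 0 < R%:R :> algC by rewrite ltr0n expn_gt0 (ltnW q_gt1).
move/(lerXn2r 2); rewrite !nnegrE normr_ge0 ler0n => /(_ isT isT).
rewrite real_normK ?kloosterman_real // natrM exprMn => le1.
have {}le1 : kloosterman psi' c' ^+ 2 / #|L|%:R <= B.
  by rewrite cardLR natrX ler_pdivrMr ?exprn_gt0 // /B natrX.
have boundk : B / (u - 4) < 4 ^+ k.
  have Bu : 0 <= B / (u - 4) by rewrite divr_ge0 ?ler0n // ltW.
  apply: lt_le_trans (archi_boundP Bu) _; rewrite -natrX ler_nat.
  by apply: leq_trans (ltnW (ltn_expl k _)) => //; rewrite leq_addr.
rewrite ltr_pdivrMr // in boundk.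
have := lt_le_trans boundk (le_trans growth (lerB le1 (lexx 4))).
by rewrite ltrBrDr gtrDl lt_gtF ?ltr0n.
Qed.

(** * Distances for a quadratic form *)

Section SumOfTwoSquares.

Variable F : finFieldType.
Hypothesis oddF : odd #|F|.
Local Notation eta := (@quad_char F).

(** Otherwise eta(s - u^2) = -1 for every u, with total -q; but that total is the sum of eta(s - t)
    eta(t) over nonzero t, of modulus at most q - 1. *)
Lemma sum_two_squares (s : F) : exists u v, s = u ^+ 2 + v ^+ 2.
Proof.
have [/existsP[u /existsP[v /eqP ->]]|nex] :=
  boolP [exists u, exists v, s == u ^+ 2 + v ^+ 2]; first by exists u, v.
have etaN1 u : eta (s - u ^+ 2) = -1.
  apply/eqP; rewrite -subr_eq0 opprK addrC -card_sqrt // pnatr_eq0 cards_eq0.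
  apply/eqP/setP => v; rewrite !inE; apply: contraNF nex => /eqP vE.
  by apply/existsP; exists u; apply/existsP; exists v; rewrite vE addrC subrK.
have := sum_fiber predT (fun u : F => u ^+ 2) (fun t => eta (s - t)).
rewrite (eq_bigr (fun=> -1)) => [|u _]; last exact: etaN1.
under [RHS]eq_bigr => t _ do rewrite card_sqrt // mulrDr mulr1.
rewrite big_split /= [X in _ = X + _](reindex_inj (inv_inj (subKr s))) /=.
under [X in _ = X + _]eq_bigr => t _ do rewrite subKr.
rewrite sum_quad_char // add0r sumr_const => /(congr1 Num.norm).
rewrite normrMn normrN1 (bigD1 0) //= quad_char0 mulr0 add0r => le1.
have : #|F|%:R <= (#|F|.-1)%:R :> algC.
  rewrite [X in X <= _](_ : _ = `|\sum_(t | t != 0) eta (s - t) * eta t|) //.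
  rewrite (le_trans (ler_norm_sum _ _ _)) // -(cardC1 (0 : F)) -sum1_card natr_sum.
  apply: ler_sum => t _; rewrite normrM.
  have le1eta x : `|eta x| <= 1.
    by have [->|x0] := eqVneq x 0; rewrite ?quad_char0 ?normr0 ?ler01 // quad_char_norm.
  by rewrite mulr_ile1.
by rewrite ler_nat leqNgt ltn_predL ltnW // finNzRing_gt1.
Qed.

End SumOfTwoSquares.

(** * Gauss sums and Fourier analysis attached to a quadratic form *)

Section QuadraticForm.

Variables (F : finFieldType) (d : nat) (Q : 'rV[F]_d -> F).
Hypothesis ndQ : nondegenerate_quadratic_form Q.
Local Notation V := 'rV[F]_d.
Local Notation B := (polar Q).

Lemma quadratic_formZ a x : Q (a *: x) = a ^+ 2 * Q x.
Proof. by case: ndQ => -[]. Qed.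

Lemma quadratic_formD x y : Q (x + y) = Q x + Q y + B x y.
Proof. by rewrite /polar; ring. Qed.

Lemma quadratic_formN x : Q (- x) = Q x.
Proof. by rewrite -scaleN1r quadratic_formZ sqrrN expr1n mul1r. Qed.

Lemma quadratic_form0 : Q 0 = 0.
Proof. by rewrite -(scale0r 0) quadratic_formZ expr0n mul0r. Qed.

Lemma polarC x y : B x y = B y x.
Proof. by rewrite /polar [y + x]addrC; ring. Qed.

Lemma polarDl x y z : B (x + y) z = B x z + B y z.
Proof. by case: ndQ => -[_ [lin _]] _; have := lin z 1 x y; rewrite /= scale1r mul1r. Qed.

Lemma polar0l z : B 0 z = 0.
Proof. by apply: (addIr (B 0 z)); rewrite -polarDl !add0r. Qed.

Lemma polarZl a x z : B (a *: x) z = a * B x z.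
Proof.
by case: ndQ => -[_ [lin _]] _; have := lin z a x 0; rewrite /= !addr0 => ->;
  rewrite polar0l addr0.
Qed.

Lemma polarDr x y z : B x (y + z) = B x y + B x z.
Proof. by rewrite !(polarC x) polarDl. Qed.

Lemma polarZr a x y : B x (a *: y) = a * B x y.
Proof. by rewrite !(polarC x) polarZl. Qed.

Variable psi : F -> algC.
Hypotheses (psiP : add_char psi) (oddF : odd #|F|).
Local Notation q := (#|F|%:R : algC).

Let psiD : {morph psi : x y / x + y >-> x * y}. Proof. by case: psiP. Qed.
Let psi0 : psi 0 = 1. Proof. by case: psiP. Qed.

Lemma card_rV_natr : #|{: V}|%:R = q ^+ d :> algC.
Proof. by rewrite card_mx mul1n natrX. Qed.

(** For z != 0, nondegeneracy provides a translation of m that multiplies the sum by a value of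
    [psi] other than 1. *)
Lemma sum_polar z : \sum_m psi (B m z) = if z == 0 then q ^+ d else 0.
Proof.
have [->|z0] := eqVneq z 0.
  under eq_bigr => m _ do rewrite polarC polar0l psi0.
  by rewrite sumr_const card_rV_natr.
have /existsP[y yz] : [exists y, B z y != 0].
  apply: contraNT z0; rewrite negb_exists => /forallP Bz0; apply/eqP.
  by case: ndQ => _; apply=> y; apply/eqP; rewrite -[_ == _]negbK.
have [_ _ [a a1]] := psiP.
pose t := (a / B z y) *: y.
have Bt : B t z = a by rewrite polarZl (polarC y) divfK.
have : psi (B t z) * (\sum_m psi (B m z)) = \sum_m psi (B m z).
  rewrite mulr_sumr [RHS](reindex_inj (addrI t)) /=.
  by apply: eq_bigr => m _; rewrite polarDl [RHS]psiD.
move/eqP; rewrite Bt -subr_eq0 -[X in _ - X]mul1r -mulrBl mulf_eq0 subr_eq0.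
by rewrite (negbTE a1) => /eqP.
Qed.

Definition quad_gauss s := \sum_z psi (s * Q z).
Local Notation G := quad_gauss.

Lemma sum_polar_scale s z : s != 0 ->
  \sum_m psi (s * B m z) = if z == 0 then q ^+ d else 0.
Proof.
move=> s0; under eq_bigr => m _ do rewrite -polarZr.
by rewrite sum_polar scaler_eq0 (negbTE s0).
Qed.

Lemma quad_gauss_norm s : s != 0 -> `|G s| ^+ 2 = q ^+ d.
Proof.
move=> s0; rewrite normCK /quad_gauss rmorph_sum big_distrlr exchange_big /=.
transitivity (\sum_w psi (s * Q w) * \sum_y psi (s * B y w)).
  under [RHS]eq_bigr => w _ do rewrite mulr_sumr.
  rewrite [RHS]exchange_big; apply: eq_bigr => y _ /=.
  rewrite (reindex_inj (addrI y)); apply: eq_bigr => w _ /=.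
  rewrite add_char_conj // -!psiD quadratic_formD; congr psi; ring.
rewrite (bigD1 0) //= [X in _ + X]big1 ?addr0 => [|w w0].
  by rewrite sum_polar_scale // eqxx quadratic_form0 mulr0 psi0 mul1r.
by rewrite sum_polar_scale // (negbTE w0) mulr0.
Qed.

Lemma quad_gauss_scale_sqr s a : a != 0 -> G (s * a ^+ 2) = G s.
Proof.
move=> a0; rewrite /quad_gauss [RHS](reindex_inj (scalerI a0)) /=.
by apply: eq_bigr => z _; rewrite quadratic_formZ mulrA.
Qed.

(* Writing s = u^2 + v^2, the similitude (x, y) |-> (u x - v y, v x + u y) multiplies
   Q(x) + Q(y) by s. *)
Lemma quad_gauss_sqr s : s != 0 -> G s ^+ 2 = G 1 ^+ 2.
Proof.
move=> s0; have [u [v sE]] := sum_two_squares oddF s.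
have GG a : G a ^+ 2 = \sum_(p : V * V) psi (a * (Q p.1 + Q p.2)).
  rewrite expr2 /quad_gauss big_distrlr pair_big /=.
  by apply: eq_bigr => p _; rewrite -psiD mulrDr.
rewrite !GG [RHS](reindex (fun p : V * V => (u *: p.1 - v *: p.2, v *: p.1 + u *: p.2))) /=.
  apply: eq_bigr => -[x y] _ /=; rewrite mul1r sE; congr psi.
  rewrite !quadratic_formD quadratic_formN -scaleNr !polarZl !polarZr !quadratic_formZ.
  ring.
exists (fun p => (s^-1 *: (u *: p.1 + v *: p.2), s^-1 *: (u *: p.2 - v *: p.1))) => -[x y] _ /=;
  apply/pair_equal_spec; split; apply/rowP => i; rewrite !mxE sE; field; rewrite -sE //.
Qed.

(** G depends only on the square class of s, and its values on the two classes have equal squares;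
    the sign between them decides the case. No diagonalization of [Q] is involved. *)
Lemma quad_gauss_dichotomy :
  (forall s, s != 0 -> G s = G 1) \/
  (forall s, s != 0 -> G s = quad_char s * G 1).
Proof.
have [nu enu] := exists_nonsquare oddF.
have nu0 : nu != 0.
  by apply: contra_eq_neq enu => ->; rewrite quad_char0 eq_sym oppr_eq0 oner_eq0.
have Gsq s : s != 0 -> quad_char s = 1 -> G s = G 1.
  move=> s0 es; have [e se] := quad_char1_sqr oddF es.
  by rewrite se -[e ^+ 2]mul1r quad_gauss_scale_sqr //; move: s0; rewrite se expf_eq0.
have Gnsq s : s != 0 -> quad_char s = -1 -> G s = G nu.
  move=> s0 es; have [|e se] := @quad_char1_sqr _ oddF (s / nu).
    by rewrite quad_charM // quad_charV // es enu mulrNN mulr1.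
  have -> : s = nu * e ^+ 2 by rewrite -se mulrC divfK.
  rewrite quad_gauss_scale_sqr //; apply: contraNneq s0 => e0.
  by move/eqP: se; rewrite e0 expr0n mulf_eq0 invr_eq0 (negbTE nu0) orbF.
have /eqP := quad_gauss_sqr nu0; rewrite eqf_sqr => /orP[] /eqP Gnu; [left|right] => s s0;
  case: (quad_char_cases s0) => es; rewrite ?es ?mul1r ?mulN1r.
- exact: Gsq.
- by rewrite -Gnu Gnsq.
- exact: Gsq.
- by rewrite -Gnu Gnsq.
Qed.

(** The phase is -t(s + (c/t)/s), so for the character x -> psi(-t x), nontrivial since t != 0, the
    sum is G(1) times a Kloosterman or a Salie sum. *)
Lemma quad_phase_sum t c : t != 0 ->
  `|\sum_(s | s != 0) G s * psi (- (s * t) - c / s)| ^+ 2 <= 4 * q ^+ d.+1.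
Proof.
move=> t0; have Nt0 : - t != 0 by rewrite oppr_eq0.
pose psit x := psi (- t * x).
have psitP : add_char psit by exact: add_char_scale.
have phase s : psi (- (s * t) - c / s) = psit (s + (c / t) / s).
  rewrite /psit; congr psi; rewrite mulrDr mulNr [t * s]mulrC; congr (_ + _).
  by rewrite mulrA mulNr [t * _]mulrC divfK // mulNr.
under eq_bigr => s _ do rewrite phase.
have [GE|GE] := quad_gauss_dichotomy.
  rewrite (eq_bigr (fun s => G 1 * psit (s + (c / t) / s))) => [|s s0]; last by rewrite GE.
  rewrite -mulr_sumr normrM exprMn quad_gauss_norm ?oner_eq0 // [q ^+ d.+1]exprSr.
  rewrite [X in _ <= X]mulrCA ler_wpM2l ?exprn_ge0 ?ler0n // real_normK ?kloosterman_real //.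
  exact: kloosterman_bound.
rewrite (eq_bigr (fun s => G 1 * (quad_char s * psit (s + (c / t) / s)))) => [|s s0];
  last by rewrite GE // mulrAC mulrC.
rewrite -mulr_sumr normrM exprMn quad_gauss_norm ?oner_eq0 // [q ^+ d.+1]exprSr [X in _ <= X]mulrCA.
by rewrite ler_wpM2l ?exprn_ge0 ?ler0n // salie_bound.
Qed.

Variable E : {set V}.

(** The squared modulus of the Fourier coefficient at m of the indicator of [E]. *)
Definition energy_coef m := `|\sum_(x in E) psi (B m x)| ^+ 2.

Lemma energy_coef_ge0 m : 0 <= energy_coef m.
Proof. by rewrite exprn_ge0. Qed.

Lemma energy_coefE m : energy_coef m = \sum_(x in E) \sum_(y in E) psi (B m (x - y)).
Proof.
rewrite /energy_coef normCK rmorph_sum big_distrlr /=.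
apply: eq_bigr => x _; apply: eq_bigr => y _.
rewrite add_char_conj // -psiD -[- y]scaleN1r polarDr polarZr mulN1r //.
Qed.

(** Plancherel's identity. *)
Lemma sum_energy_coef : \sum_m energy_coef m = q ^+ d * #|E|%:R.
Proof.
under eq_bigr => m _ do rewrite energy_coefE.
rewrite exchange_big /= -[#|E|]sum1_card natr_sum mulr_sumr; apply: eq_bigr => x xE.
rewrite exchange_big /= (bigD1 x) //= sum_polar subrr eqxx mulr1.
rewrite big1 ?addr0 // => y /andP[_ yx].
by rewrite sum_polar subr_eq0 eq_sym (negbTE yx).
Qed.

Definition dist_exp_sum s := \sum_(x in E) \sum_(y in E) psi (s * Q (x - y)).
Local Notation H := dist_exp_sum.

(** A Gaussian is its own Fourier transform: after completing the square, the sum over m selects w =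
    -z and recovers psi(s Q(z)). *)
Lemma dist_exp_sumE s : s != 0 ->
  q ^+ d * H s = G s * \sum_m psi (- (Q m / s)) * energy_coef m.
Proof.
move=> s0.
have phase z : q ^+ d * psi (s * Q z) =
    G s * \sum_m psi (- (s * Q m)) * psi (s * B m z).
  rewrite /quad_gauss big_distrlr exchange_big /=.
  transitivity (\sum_w psi (s * Q w) * \sum_m psi (s * B m (w + z))).
    rewrite (bigD1 (- z)) //= [X in _ + X]big1 ?addr0 => [|w wz].
      by rewrite addNr sum_polar_scale // eqxx quadratic_formN mulrC.
    by rewrite sum_polar_scale // addr_eq0 (negbTE wz) mulr0.
  under [LHS]eq_bigr => w _ do rewrite mulr_sumr.
  rewrite exchange_big /=; apply: eq_bigr => m _.
  rewrite [RHS](reindex_inj (addIr m)); apply: eq_bigr => w _ /=.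
  rewrite -!psiD quadratic_formD polarDr (polarC w); congr psi; ring.
rewrite /dist_exp_sum [LHS]mulr_sumr.
transitivity (\sum_(x in E) \sum_(y in E)
    G s * \sum_m psi (- (s * Q m)) * psi (s * B m (x - y))).
  by apply: eq_bigr => x _; rewrite mulr_sumr; apply: eq_bigr => y _; exact: phase.
have -> : \sum_m psi (- (Q m / s)) * energy_coef m =
    \sum_(x in E) \sum_(y in E) \sum_m psi (- (s * Q m)) * psi (s * B m (x - y)).
  under [RHS]eq_bigr => x _ do rewrite exchange_big.
  (* Scaling m by s turns Q(m)/s into s Q(m). *)
  rewrite [RHS]exchange_big (reindex_inj (scalerI s0)) /=.
  apply: eq_bigr => m _; rewrite energy_coefE mulr_sumr; apply: eq_bigr => x _.
  rewrite mulr_sumr; apply: eq_bigr => y _.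
  rewrite polarZl quadratic_formZ; congr (psi (- _) * _).
  by rewrite expr2 mulrAC mulfK // mulrC.
by rewrite mulr_sumr; apply: eq_bigr => x _; rewrite mulr_sumr.
Qed.

Lemma dist_exp_sum_bound s : s != 0 -> `|H s| ^+ 2 <= q ^+ d * #|E|%:R ^+ 2.
Proof.
move=> s0; have q0 : 0 < q ^+ d by rewrite exprn_gt0 // ltr0n ltnW // finNzRing_gt1.
rewrite -(ler_pM2l (exprn_gt0 2 q0)) -{1}(ger0_norm (ltW q0)) -exprMn -normrM.
rewrite dist_exp_sumE // normrM exprMn quad_gauss_norm //.
have -> : (q ^+ d) ^+ 2 * (q ^+ d * #|E|%:R ^+ 2) = q ^+ d * (q ^+ d * #|E|%:R) ^+ 2.
  by ring.
rewrite ler_wpM2l ?(ltW q0) //.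
rewrite lerXn2r ?nnegrE ?mulr_ge0 ?ler0n ?(ltW q0) // -sum_energy_coef.
rewrite (le_trans (ler_norm_sum _ _ _)) //; apply: ler_sum => m _.
by rewrite normrM (add_char_norm psiP) mul1r ger0_norm // energy_coef_ge0.
Qed.

Definition dist_count t := #|[set p : V * V | [&& p.1 \in E, p.2 \in E & Q (p.1 - p.2) == t]]|.
Local Notation N := dist_count.

Lemma dist_countE t :
  q * (N t)%:R - #|E|%:R ^+ 2 = \sum_(s | s != 0) psi (- (s * t)) * H s.
Proof.
have H0 : H 0 = #|E|%:R ^+ 2.
  rewrite /dist_exp_sum; under eq_bigr => x _ do under eq_bigr => y _ do rewrite mul0r psi0.
  under eq_bigr => x _ do rewrite sumr_const.
  by rewrite sumr_const expr2 mulr_natr.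
suff -> : q * (N t)%:R = \sum_s psi (- (s * t)) * H s.
  by rewrite (bigD1 0) //= mul0r oppr0 psi0 mul1r H0 addrAC subrr add0r.
rewrite /dist_exp_sum; under eq_bigr => s _ do rewrite pair_big /= mulr_sumr.
rewrite exchange_big /= /dist_count -[in LHS]sum1dep_card natr_sum mulr_sumr.
rewrite [LHS]big_mkcond [RHS]big_mkcond /=; apply: eq_bigr => -[x y] _ /=.
case: (x \in E) => //=; case: (y \in E) => //=.
rewrite (eq_bigr (fun s => psi ((Q (x - y) - t) * s))) => [|s _].
  by rewrite sum_add_char // subr_eq0 mulr1.
by rewrite -psiD; congr psi; ring.
Qed.

(** After exchanging sums, each [energy_coef m] is weighted by a phase sum of modulus at most 2
    q^((d+1)/2), uniformly in m; Plancherel's identity does the rest. *)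
Lemma dist_count_bound t : t != 0 ->
  (q * (N t)%:R - #|E|%:R ^+ 2) ^+ 2 <= 4 * q ^+ d.+1 * #|E|%:R ^+ 2.
Proof.
move=> t0; have q0 : 0 < q ^+ d by rewrite exprn_gt0 // ltr0n ltnW // finNzRing_gt1.
have realN : q * (N t)%:R - #|E|%:R ^+ 2 \is Num.real.
  by rewrite rpredB ?rpredM ?rpredX ?realn.
rewrite -real_normK //.
rewrite -(ler_pM2l (exprn_gt0 2 q0)) -{1}(ger0_norm (ltW q0)) -exprMn -normrM.
pose T m := \sum_(s | s != 0) G s * psi (- (s * t) - Q m / s).
have -> : q ^+ d * (q * (N t)%:R - #|E|%:R ^+ 2) = \sum_m energy_coef m * T m.
  rewrite dist_countE mulr_sumr.
  under [RHS]eq_bigr => m _ do rewrite mulr_sumr.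
  rewrite [RHS]exchange_big /=; apply: eq_bigr => s s0.
  rewrite mulrCA dist_exp_sumE // mulr_sumr mulr_sumr; apply: eq_bigr => m _.
  by rewrite psiD; ring.
pose M : algC := sqrtC (4 * q ^+ d.+1).
have M0 : 0 <= M by rewrite sqrtC_ge0 mulr_ge0 ?exprn_ge0 ?ler0n.
have TM m : `|T m| <= M.
  rewrite -(@ler_pXn2r _ 2) ?nnegrE // sqrtCK; exact: quad_phase_sum.
have -> : (q ^+ d) ^+ 2 * (4 * q ^+ d.+1 * #|E|%:R ^+ 2) =
    (q ^+ d * #|E|%:R * M) ^+ 2 by rewrite !exprMn sqrtCK; ring.
rewrite lerXn2r ?nnegrE ?mulr_ge0 ?ler0n ?(ltW q0) // -sum_energy_coef mulr_suml.
rewrite (le_trans (ler_norm_sum _ _ _)) //; apply: ler_sum => m _.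
by rewrite normrM ger0_norm ?energy_coef_ge0 // ler_wpM2l ?energy_coef_ge0.
Qed.

(** Parseval's identity in t, then the bound on each H(s). No Kloosterman bound enters, so t = 0 is
    included. *)
Lemma dist_count_variance :
  \sum_t (q * (N t)%:R - #|E|%:R ^+ 2) ^+ 2 <= q ^+ d.+2 * #|E|%:R ^+ 2.
Proof.
have realN t : q * (N t)%:R - #|E|%:R ^+ 2 \is Num.real.
  by rewrite rpredB ?rpredM ?rpredX ?realn.
have -> : \sum_t (q * (N t)%:R - #|E|%:R ^+ 2) ^+ 2 =
    q * \sum_(s | s != 0) `|H s| ^+ 2.
  transitivity (\sum_t \sum_(s | s != 0) \sum_(r | r != 0)
      psi (- (s * t)) * H s * (psi (- (r * t)) * H r)^*).
    apply: eq_bigr => t _; rewrite -real_normK // normCK dist_countE.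
    by rewrite rmorph_sum big_distrlr.
  rewrite exchange_big mulr_sumr /=; apply: eq_bigr => s s0.
  rewrite exchange_big (bigD1 s) //= [X in _ + X]big1 ?addr0 => [|r /andP[r0 rs]].
    rewrite (eq_bigr (fun=> `|H s| ^+ 2)) => [|t _].
      by rewrite sumr_const mulr_natl.
    by rewrite -normCK normrM (add_char_norm psiP) mul1r.
  rewrite (eq_bigr (fun t => H s * (H r)^* * psi ((r - s) * t))) => [|t _].
    by rewrite -mulr_sumr sum_add_char // subr_eq0 (negbTE rs) mulr0.
  rewrite rmorphM /= (add_char_conj psiP) opprK.
  have -> : psi ((r - s) * t) = psi (- (s * t)) * psi (r * t).
    by rewrite -psiD; congr psi; ring.
  by rewrite mulrACA mulrC.
have -> : q ^+ d.+2 * #|E|%:R ^+ 2 = q * (q * (q ^+ d * #|E|%:R ^+ 2)).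
  by rewrite [q ^+ d.+2]exprS [q ^+ d.+1]exprS !mulrA.
rewrite ler_wpM2l ?ler0n //.
rewrite (le_trans (ler_sum _ (fun s s0 => dist_exp_sum_bound s0))) //.
rewrite sumr_const -[X in X <= _]mulr_natl.
by rewrite ler_wpM2r ?mulr_ge0 ?exprn_ge0 ?ler0n // ler_nat max_card.
Qed.

End QuadraticForm.

(** * Counting distances *)

(** The Fourier bounds live in [algC], the theorem in a real field; since both sides are integers,
    the inequality passes through [int]. *)
Lemma sum_sqr_natr_transfer (A B : numDomainType) (T : finType) (S : pred T)
    (a : T -> nat) (b c : nat) :
  \sum_(t | S t) ((a t)%:R - b%:R) ^+ 2 <= c%:R :> A ->
  \sum_(t | S t) ((a t)%:R - b%:R) ^+ 2 <= c%:R :> B.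
Proof.
have cast (C : numDomainType) : \sum_(t | S t) ((a t)%:R - b%:R) ^+ 2 =
    (\sum_(t | S t) ((a t)%:Z - b%:Z) ^+ 2)%:~R :> C.
  by rewrite rmorph_sum; apply: eq_bigr => t _; rewrite rmorphXn rmorphB /= !pmulrn.
by rewrite !cast !pmulrn !ler_int.
Qed.

Section Counting.

(** In the application n = q, w = q^(1/2), G = q^((d-1)/2), e = q^eps, X = |E| and t0 = 0, so that n
    G = q^((d+1)/2). *)
Variables (R : realFieldType) (T : finType) (t0 : T) (S : {set T}) (N : T -> R).
Variables n w G e X : R.
Hypotheses (nE : n = #|T|%:R) (w2 : w ^+ 2 = n) (w0 : 0 < w) (G0 : 0 < G).
Hypotheses (n12 : 12 <= n) (e4 : 4 <= e) (XE : 3 * (w * G * e) <= X).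
Hypotheses (t0S : t0 \in S) (N0 : forall t, t \notin S -> N t = 0).
Hypothesis sumN : \sum_t N t = X ^+ 2.
Hypothesis bound : forall t, t != t0 -> (n * N t - X ^+ 2) ^+ 2 <= 4 * (n * G * X) ^+ 2.
Hypothesis variance : \sum_t (n * N t - X ^+ 2) ^+ 2 <= n * (n * G * X) ^+ 2.

Local Notation D := (#|S|%:R : R).

Let X0 : 0 < X.
Proof. by apply: lt_le_trans XE; rewrite !mulr_gt0 // (lt_le_trans _ e4). Qed.

Let n0 : 0 < n. Proof. exact: lt_le_trans n12. Qed.

Let bound_abs t : t != t0 -> `|n * N t - X ^+ 2| <= 2 * (n * G * X).
Proof.
move=> tt0; rewrite -(@ler_pXn2r _ 2) ?nnegrE ?mulr_ge0 ?(ltW n0) ?(ltW G0) ?(ltW X0) //.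
rewrite real_normK ?num_real // (le_trans (bound tt0)) //.
by rewrite [X in _ <= X]exprMn ler_wpM2r ?sqr_ge0 // -natrX.
Qed.

(** At [t0] a single term of the variance is used, which costs a factor w instead of 2. *)
Let bound_t0 : `|n * N t0 - X ^+ 2| <= w * (n * G * X).
Proof.
rewrite -(@ler_pXn2r _ 2) ?nnegrE ?mulr_ge0 ?(ltW n0) ?(ltW G0) ?(ltW X0) ?(ltW w0) //.
rewrite real_normK ?num_real // [X in _ <= X]exprMn w2 (le_trans _ variance) //.
by rewrite [X in _ <= X](bigD1 t0) //= lerDl sumr_ge0 // => t _; rewrite sqr_ge0.
Qed.

Let sumNS : \sum_(t in S) N t = X ^+ 2.
Proof.
by rewrite -sumN [RHS](bigID (mem S)) /= [X in _ + X]big1 ?addr0 //.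
Qed.

Lemma count_small : X <= n * G / 2 -> X / (3 * G) <= D.
Proof.
move=> Xs; have upper : n * X ^+ 2 <= (X ^+ 2 + w * (n * G * X)) + D * (X ^+ 2 + 2 * (n * G * X)).
  rewrite -sumNS mulr_sumr (bigD1 t0) //= sumNS lerD //.
    by have := bound_t0; rewrite ler_distl => /andP[_]; rewrite addrC.
  apply: le_trans (_ : \sum_(t in S | t != t0) (X ^+ 2 + 2 * (n * G * X)) <= _).
    by apply: ler_sum => t /andP[_ tt0]; have := bound_abs tt0; rewrite ler_distl => /andP[].
  rewrite sumr_const -[X in X <= _]mulr_natl ler_wpM2r //.
    by rewrite addr_ge0 ?sqr_ge0 ?mulr_ge0 ?(ltW n0) ?(ltW G0) ?(ltW X0).
  by rewrite ler_nat subset_leq_card //; apply/subsetP => t; rewrite unfold_in => /andP[].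
have wGe : w * G * e <= X / 3 by rewrite ler_pdivlMr // mulrC.
have wG4 : 4 * (w * G) <= X / 3.
  by apply: le_trans wGe; rewrite mulrC ler_wpM2l // mulr_ge0 ?ltW.
have D0 : 0 <= D by rewrite ler0n.
have upper' : n * X <= X + w * G * n + D * (X + 2 * (n * G)).
  rewrite -(ler_pM2r X0); apply: le_trans (le_trans upper _);
    by rewrite le_eqVlt; apply/orP; left; apply/eqP; ring.
(* The t0 term costs nX/12 by e >= 4, the term X costs nX/12 by n >= 12. The remaining 5/6, divided
   by 5/2, is exactly 1/3. *)
have l1 : w * G * n <= X / 12 * n by rewrite ler_wpM2r ?(ltW n0) //; lra.
have l2 : D * (X + 2 * (n * G)) <= D * (5 / 2 * (n * G)) by rewrite ler_wpM2l //; lra.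
have l3 : X <= n * X / 12 by rewrite ler_pdivlMr // mulrC ler_wpM2r ?(ltW X0).
rewrite ler_pdivrMr ?mulr_gt0 // -(ler_pM2l n0).
have -> : n * (D * (3 * G)) = 6 / 5 * (D * (5 / 2 * (n * G))) by field.
lra.
Qed.

Lemma count_medium : n * G / 2 <= X -> X <= 5 / 2 * (n * G) -> X / (3 * G) <= D.
Proof.
move=> Xl Xu; pose S2 := \sum_(t in S) (n * N t) ^+ 2.
have D0 : 0 < D by rewrite ltr0n; apply/card_gt0P; exists t0.
have sumnN : \sum_t (n * N t) = n * X ^+ 2 by rewrite -mulr_sumr sumN.
(* The mean of n N(t) is X^2, so its second moment is the variance plus n X^4. *)
have S2u : S2 <= n * (n * G * X) ^+ 2 + n * X ^+ 4.
  have : S2 <= \sum_t (n * N t) ^+ 2.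
    rewrite [X in _ <= X](bigID (mem S)) /= lerDl sumr_ge0 // => t _; exact: sqr_ge0.
  move/le_trans; apply; rewrite -lerBlDr (le_trans _ variance) //.
  rewrite [X in _ <= X](eq_bigr (fun t => (n * N t) ^+ 2 - 2 * X ^+ 2 * (n * N t) + X ^+ 4));
    last first.
    by move=> t _ /=; ring.
  rewrite big_split sumrB /= -[X in _ - X + _]mulr_sumr sumnN sumr_const -[X in _ <= _ + X]mulr_natl -nE.
  by rewrite le_eqVlt; apply/orP; left; apply/eqP; ring.
have const : \sum_(t in S) (n * X ^+ 2) ^+ 2 = D * (n * X ^+ 2) ^+ 2.
  by rewrite sumr_const mulr_natl.
have e1 : \sum_(t in S) D ^+ 2 * (n * N t) ^+ 2 = D ^+ 2 * S2 by rewrite -mulr_sumr.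
have e2 : \sum_(t in S) 2 * D * (n * X ^+ 2) * (n * N t) = 2 * D * (n * X ^+ 2) ^+ 2.
  by rewrite -mulr_sumr -mulr_sumr sumNS; ring.
(* Cauchy-Schwarz *)
have cs : (n * X ^+ 2) ^+ 2 <= D * S2.
  have : 0 <= \sum_(t in S) (D * (n * N t) - n * X ^+ 2) ^+ 2.
    by apply: sumr_ge0 => t _; rewrite sqr_ge0.
  rewrite (eq_bigr (fun t => D ^+ 2 * (n * N t) ^+ 2 - 2 * D * (n * X ^+ 2) * (n * N t)
      + (n * X ^+ 2) ^+ 2)); last by move=> t _ /=; ring.
  rewrite big_split sumrB /= e1 e2 const.
  rewrite (_ : _ + _ = D * (D * S2 - (n * X ^+ 2) ^+ 2)); last by ring.
  by rewrite pmulr_rge0 // subr_ge0.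
have key : n * X ^+ 2 <= D * ((n * G) ^+ 2 + X ^+ 2).
  have nX2 : 0 < n * X ^+ 2 by rewrite mulr_gt0 ?exprn_gt0.
  rewrite -(ler_pM2r nX2) -expr2 (le_trans cs) //.
  rewrite -mulrA ler_wpM2l ?(ltW D0) // (le_trans S2u) //.
  by rewrite le_eqVlt; apply/orP; left; apply/eqP; ring.
(* The range of X makes (X - nG/2)(5nG/2 - X) nonnegative, that is, X^2 + (5/4)(nG)^2 <= 3 nG X. *)
have quad : (n * G) ^+ 2 + X ^+ 2 <= 3 * (n * G) * X.
  have := mulr_ge0 (_ : 0 <= X - n * G / 2) (_ : 0 <= 5 / 2 * (n * G) - X).
  by rewrite !subr_ge0 => /(_ Xl Xu); have := sqr_ge0 (n * G); nra.
rewrite ler_pdivrMr ?mulr_gt0 //.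
have nX : 0 < n * X by rewrite mulr_gt0.
rewrite -(ler_pM2r nX).
have -> : X * (n * X) = n * X ^+ 2 by ring.
rewrite (le_trans key) // (_ : D * (3 * G) * (n * X) = D * (3 * (n * G) * X)); last by ring.
by rewrite ler_wpM2l ?(ltW D0).
Qed.

(** A value t != t0 with N(t) = 0 would force X <= 2 n G by the pointwise bound. *)
Lemma count_large : 5 / 2 * (n * G) < X -> D = n.
Proof.
move=> Xl; rewrite nE; congr _%:R; apply: eq_card => t; rewrite [RHS]inE.
have [->//|tt0] := eqVneq t t0; apply: contraT => /N0 Nt.
have := bound_abs tt0; rewrite Nt mulr0 sub0r normrN ger0_norm ?sqr_ge0 //.
rewrite expr2 mulrA ler_pM2r // => le2; have nG : 0 < n * G by exact: mulr_gt0.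
by exfalso; move: Xl le2; lra.
Qed.

Lemma count_lower_bound : Num.min (X / (3 * G)) n <= D.
Proof.
rewrite ge_min; have [Xs|Xl] := leP X (n * G / 2); first by rewrite count_small.
have [Xu|Xll] := leP X (5 / 2 * (n * G)); first by rewrite (count_medium (ltW Xl)).
by rewrite (count_large Xll) lexx orbT.
Qed.

End Counting.

Lemma sum_dist_count (F : finFieldType) (d : nat) (Q : 'rV[F]_d -> F) (E : {set 'rV[F]_d}) :
  (\sum_t dist_count Q E t = #|E| ^ 2)%N.
Proof.
rewrite /dist_count; under eq_bigr => t _ do rewrite -sum1dep_card big_mkcond.
rewrite exchange_big -mulnn -cardsX -sum1_card [RHS]big_mkcond /=.
apply: eq_bigr => -[x y] _; rewrite in_setX /=.
case: (x \in E) => /=; last by rewrite big1.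
case: (y \in E) => /=; last by rewrite big1.
rewrite -big_mkcond sum1dep_card -[RHS](cards1 (Q (x - y))).
by apply: eq_card => t; rewrite !inE eq_sym.
Qed.

Lemma dist_count_notin (F : finFieldType) (d : nat) (Q : 'rV[F]_d -> F)
    (E : {set 'rV[F]_d}) t :
  t \notin distance_set Q E -> dist_count Q E t = 0%N.
Proof.
move=> tD; apply/eqP; rewrite cards_eq0; apply/eqP/setP => -[x y]; rewrite !inE /=.
apply: contraNF tD => /and3P[xE yE /eqP <-].
by apply/imset2P; exists x y.
Qed.

Lemma powR_eventually_ge (R : realType) (eps c : R) : 0 < eps -> 0 < c ->
  exists n0 : nat, forall n : nat, (n0 <= n)%N -> c <= n%:R `^ eps.
Proof.
move=> eps0 c0; exists (Num.bound (c `^ eps^-1)) => n n0n.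
have -> : c = (c `^ eps^-1) `^ eps.
  by rewrite -powRrM mulVf ?gt_eqF // powRr1 // ltW.
apply: ge0_ler_powR; rewrite ?nnegrE ?powR_ge0 ?(ltW eps0) ?ler0n //.
by rewrite (le_trans (ltW (archi_boundP (powR_ge0 _ _)))) // ler_nat.
Qed.

Theorem theorem3 (R : realType) (d : nat) (eps : R) (hd : (2 <= d)%N)
    (heps : 0 < eps) :
  exists q0 : nat, forall (q : nat) (F : finFieldType),
    #|F| = q -> odd q -> (q0 <= q)%N ->
    forall (Q : 'rV[F]_d -> F) (E : {set 'rV[F]_d}),
      nondegenerate_quadratic_form Q ->
      3 * q%:R `^ (d%:R / 2 + eps) <= #|E|%:R :> R ->
      Num.min (#|E|%:R / (3 * q%:R `^ ((d%:R - 1) / 2))) q%:R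
        <= #|distance_set Q E|%:R :> R.
Proof.
(* The argument 3 of [ltr0Sn] sets the threshold at 4, the lower bound on e required by
   [count_lower_bound]. *)
have [n0 n0P] := powR_eventually_ge heps (ltr0Sn R 3).
exists (maxn 12 n0) => q F cardF oddq; rewrite geq_max => /andP[q12 q0q] Q E ndQ.
set w : R := q%:R `^ 2^-1; set G : R := q%:R `^ ((d%:R - 1) / 2).
set e : R := q%:R `^ eps.
have q0 : 0 < q%:R :> R by rewrite ltr0n (leq_trans _ q12).
have qn0 : q%:R != 0 :> R by rewrite gt_eqF.
have powD a b : q%:R `^ (a + b) = q%:R `^ a * q%:R `^ b :> R.
  by rewrite powRD // qn0 implybT.
have -> : q%:R `^ (d%:R / 2 + eps) = w * G * e :> R.
  by rewrite -!powD; congr (_ `^ _); field.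
have w0 : 0 < w by exact: powR_gt0.
have G0 : 0 < G by exact: powR_gt0.
have w2 : w ^+ 2 = q%:R.
  by rewrite expr2 -powD (_ : 2^-1 + 2^-1 = 1) ?powRr1 ?ler0n //; field.
(* This turns q^(d+1) |E|^2 into (q G |E|)^2, the form in which both Fourier bounds enter the
   counting. *)
have qd : q%:R ^+ d = q%:R * G ^+ 2 :> R.
  rewrite -[LHS]powR_mulrn ?ler0n // expr2 -powD -{2}(powRr1 (ltW q0)) -powD.
  by congr (_ `^ _); field.
move=> XE; have oddF : odd #|F| by rewrite cardF.
have [psi psiP] := exists_add_char F.
have XEpos : (0 < #|E|)%N.
  by rewrite -(ltr0n R) (lt_le_trans _ XE) // !mulr_gt0 // powR_gt0.
apply: (@count_lower_bound R F 0 (distance_set Q E) (fun t => (dist_count Q E t)%:R)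
  q%:R w G e) => //.
- by rewrite cardF.
- by rewrite (ler_nat R 12 q).
- exact: n0P.
- case/card_gt0P: XEpos => x xE; apply/imset2P; exists x x => //.
  by rewrite subrr (quadratic_form0 ndQ).
- by move=> t /dist_count_notin ->.
- by rewrite -natr_sum sum_dist_count natrX.
- move=> t t0; have := dist_count_bound ndQ psiP oddF E t0; rewrite cardF.
  have := @sum_sqr_natr_transfer algC R F (pred1 t) (fun t => q * dist_count Q E t)%N
    (#|E| ^ 2)%N (4 * q ^ d.+1 * #|E| ^ 2)%N.
  rewrite !big_pred1_eq !natrM !natrX => tr /tr /le_trans; apply.
  by rewrite exprS qd le_eqVlt; apply/orP; left; apply/eqP; ring.
have := dist_count_variance ndQ psiP E; rewrite cardF.
have := @sum_sqr_natr_transfer algC R F predT (fun t => q * dist_count Q E t)%N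
  (#|E| ^ 2)%N (q ^ d.+2 * #|E| ^ 2)%N.
have cast (C : numDomainType) :
    \sum_t ((q * dist_count Q E t)%:R - (#|E| ^ 2)%:R) ^+ 2 =
    \sum_t (q%:R * (dist_count Q E t)%:R - #|E|%:R ^+ 2) ^+ 2 :> C.
  by apply: eq_bigr => t _; rewrite natrM natrX.
rewrite /= !cast !(natrX, natrM) => tr /tr /le_trans; apply.
by rewrite !exprS qd le_eqVlt; apply/orP; left; apply/eqP; ring.
Qed.
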